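(* For every nonnegative integer $k$, \begin{align*} \mu(\underbrace{1+x,\ldots,1+x}_{k},\,1+x+y+z) &= -\frac{1}{\pi^2}\mathrm{Ls}^{(1)}_{k+3}(\pi) + \frac{1}{\pi^2}\int_0^\pi \mathrm{Ls}_2(\theta)\log^k\left(2\sin\frac{\theta}{2}\right)\mathrm{d}\theta\\ &= -\frac{1}{\pi^2}\mathrm{Ls}^{(1)}_{k+3}(\pi) - \frac{1}{\pi^2}\int_0^\pi \mathrm{Ls}_{k+1}(\theta)\log\left(2\sin\frac{\theta}{2}\right)\mathrm{d}\theta, \end{align*} where the left-hand side is the multiple Mahler measure of the $k+1$ listed polynomials in the three variables $x,y,z$.
   Context: For functions $P_1,\ldots,P_m$ of $n$ variables, the multiple Mahler measure is \[ \mu(P_1,\ldots,P_m) := \int_0^1\cdots\int_0^1 \prod_{j=1}^m \log\left|P_j\left(e^{2\pi i t_1},\ldots,e^{2\pi i t_n}\right)\right|\,\mathrm{d}t_1\cdots\mathrm{d}t_n . \] For integers $n\ge1$, $0\le j\le n-1$ and real $\sigma$: $\mathrm{Ls}_n(\sigma) := -\int_0^{\sigma}\log^{n-1}\left|2\sin\frac{\theta}{2}\right|\mathrm{d}\theta$ and the generalized log-sine integral $\mathrm{Ls}^{(j)}_n(\sigma) := -\int_0^{\sigma}\theta^j\log^{n-1-j}\left|2\sin\frac{\theta}{2}\right|\mathrm{d}\theta$. *)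

(* Defs.v *)
From HB Require Import structures.
From mathcomp Require Import all_boot all_order all_algebra.
From mathcomp Require Import all_classical all_reals all_analysis.
From mathcomp Require Import complex.
Set Implicit Arguments. Unset Strict Implicit. Unset Printing Implicit Defensive.
Import Order.TTheory GRing.Theory Num.Theory.
Import numFieldNormedType.Exports.
Local Open Scope classical_set_scope.
Local Open Scope ring_scope.

Section Defs.
Variable R : realType.

Definition expi2pi (t : R) : R[i] :=
  (cos (2 * pi * t) +i* sin (2 * pi * t))%C.

Definition leb3 := ((@lebesgue_measure R) \x (@lebesgue_measure R) \x (@lebesgue_measure R))%E.

Definition unit_cube3 : set ((R * R) * R) :=
  [set t | (t.1.1 \in `[0, 1]) /\ (t.1.2 \in `[0, 1]) /\ (t.2 \in `[0, 1])].

Definition mahler3 (Ps : seq (R[i] -> R[i] -> R[i] -> R[i])) : R :=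
  \int[leb3]_(t in unit_cube3)
     \prod_(P <- Ps) ln (Normc.normc (P (expi2pi t.1.1) (expi2pi t.1.2) (expi2pi t.2))).

Definition oint0 (sigma : R) (f : R -> R) : R :=
  if 0 <= sigma then \int[@lebesgue_measure R]_(x in `[0, sigma]) f x
  else - \int[@lebesgue_measure R]_(x in `[sigma, 0]) f x.

Definition Ls (n : nat) (sigma : R) : R :=
  - oint0 sigma (fun th => (ln `|2 * sin (th / 2)|) ^+ n.-1).

Definition Lsj (n j : nat) (sigma : R) : R :=
  - oint0 sigma (fun th => th ^+ j * (ln `|2 * sin (th / 2)|) ^+ (n.-1 - j)).

End Defs.

(* Main.v *)
(* Substituting z := y z' and applying Jensen's formula in y, for fixed x the
   (y, z)-average of ln |1 + x + y + z| is the z'-average of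
   max (ln |1 + x|, ln |1 + z'|).  Since |1 + e^(i t)| is
   2 sin (theta / 2) with theta = |t - pi|, the Mahler measure becomes
   pi^-2 times the double integral over [0, pi]^2 of
   G(theta)^k max (G theta, G phi) where G(theta) = ln (2 sin (theta / 2)).
   As G is increasing and has integral 0, the inner integral is
   theta G(theta) + Ls_2(theta); exchanging the order of integration on the
   triangle phi <= theta gives the second form.

   Jensen's formula itself needs no complex analysis here: if F(c) is the circle
   average of ln |1 + c z|, then (1 + c z)(1 - c z) = 1 - c^2 z^2 yields
   2 F(c) = F(- c^2), so F, being bounded on the disk of radius |c| < 1,
   vanishes there. *)
Require Import Defs.
From HB Require Import structures.
From mathcomp Require Import all_boot all_order all_algebra.
From mathcomp Require Import all_classical all_reals all_analysis.
From mathcomp Require Import complex.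
From mathcomp Require Import measurable_realfun ring lra.
Set Implicit Arguments.
Unset Strict Implicit.
Unset Printing Implicit Defensive.
Import Order.TTheory GRing.Theory Num.Theory.
Import numFieldNormedType.Exports.
Local Open Scope classical_set_scope.
Local Open Scope ring_scope.

(** Every integrand here has logarithmic singularities, so the work lies in integrability and in
    exceptional points. Since [ln 0 = 0], the additivity of [ln] over products fails at isolated
    parameters; these are discarded as countable sets. Since a real integral is [fine] of an
    extended one, changes of variables are proved for nonnegative functions first and then
    transferred to signed ones. Joint integrability, needed for each exchange of integrals, comes
    from Jensen's formula itself: on the circle [ln |c + z|] is at most [ln (1 + |c|)] and has
    nonnegative average, so the average of its absolute value is at most [2 * ln (1 + |c|)],
    wherever the zero lies. For [|c| = 1] the boundedness used inside the disk is lost. It is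
    replaced by the integrability of [ln |1 + z|], obtained by comparison with [th^(-1/2)]; the
    doubling identity then reads [J = 2 J]. *)

Section product_sigma_finite.
Context d1 d2 (T1 : measurableType d1) (T2 : measurableType d2) (R : realType).
Variables (m1 : {sigma_finite_measure set T1 -> \bar R})
  (m2 : {sigma_finite_measure set T2 -> \bar R}).

Let product_is_sigma_finite : sigma_finite setT (m1 \x m2)%E.
Proof.
have /sigma_finiteP[F [TF ndF Foo]] := sigma_finiteT m1.
have /sigma_finiteP[G [TG ndG Goo]] := sigma_finiteT m2.
exists (fun n => F n `*` G n).
  apply/seteqP; split => // -[x y] _.
  have [i _ Fx] : (\bigcup_i F i) x by rewrite -TF.
  have [j _ Gy] : (\bigcup_i G i) y by rewrite -TG.
  exists (maxn i j) => //; split => /=.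
    by move/subsetPset: (ndF _ _ (leq_maxl i j)); apply.
  by move/subsetPset: (ndG _ _ (leq_maxr i j)); apply.
move=> n; have [mF Fn] := Foo n; have [mG Gn] := Goo n.
split; first exact: measurableX.
by rewrite product_measure1E// lte_mul_pinfty// ge0_fin_numE.
Qed.

(* The library's canonical instance on [m1 \x m2] requires subprobabilities. *)
Definition sigma_finite_product : {sigma_finite_measure set (T1 * T2)%type -> \bar R} :=
  HB.pack (product_measure1 m1 m2)
    (@Measure_isSigmaFinite.Build _ _ _ (m1 \x m2)%E product_is_sigma_finite).

End product_sigma_finite.

(** * Fubini's theorem for real-valued integrals on rectangles *)

Section rectangles.
Context d1 d2 (T1 : measurableType d1) (T2 : measurableType d2) (R : realType).
Variables (m1 : {sigma_finite_measure set T1 -> \bar R})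
  (m2 : {sigma_finite_measure set T2 -> \bar R}).
Variables (A : set T1) (B : set T2) (mA : measurable A) (mB : measurable B).
Implicit Types (f : T1 * T2 -> R) (h : T1 * T2 -> \bar R).

(** Tonelli's measurability applies to the positive and negative parts of [f] cut off to [setT * B];
    the difference and [fine] preserve measurability, whether or not a given section is
    integrable. *)
Lemma measurable_section_Rintegral f : measurable_fun setT f ->
  measurable_fun setT (fun x => \int[m2]_(y in B) f (x, y)).
Proof.
move=> mf; apply: measurableT_comp => //.
have mg : measurable_fun setT ((EFin \o f) \_ (setT `*` B)).
  apply/(measurable_restrictT _ (measurableX measurableT mB)).
  by apply: measurable_funTS; exact/measurable_EFinP.
rewrite [X in measurable_fun _ X](_ : _ = fun x =>
  \int[m2]_y (((EFin \o f) \_ (setT `*` B)) (x, y)))%E; last first.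
  apply/funext => x; rewrite integral_mkcond; apply: eq_integral => y _.
  by rewrite !patchE in_setX in_setT.
rewrite [X in measurable_fun _ X](_ : _ = (fun x =>
    \int[m2]_y (((EFin \o f) \_ (setT `*` B))^\+ (x, y))) \-
  (fun x => \int[m2]_y (((EFin \o f) \_ (setT `*` B))^\- (x, y))))%E; last first.
  by apply/funext => x; rewrite integralE; congr (_ - _)%E;
    apply: eq_integral => y _; rewrite ?funeposE ?funenegE.
apply: emeasurable_funB; apply: measurable_fun_fubini_tonelli_F => //.
  exact: measurable_funepos.
exact: measurable_funeneg.
Qed.

Lemma integral_setX12 h : (m1 \x m2)%E.-integrable (A `*` B) h ->
  (\int[(m1 \x m2)%E]_(z in A `*` B) h z = \int[m1]_(x in A) \int[m2]_(y in B) h (x, y))%E.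
Proof.
move=> /(integrable_mkcond _ (measurableX mA mB)) ih.
rewrite integral_mkcond -integral12_prod_meas1// [RHS]integral_mkcond.
apply: eq_integral => x _; rewrite /fubini_F patchE; case: ifPn => xA.
  by rewrite [RHS]integral_mkcond; apply: eq_integral => y _;
    rewrite !patchE in_setX xA.
by apply: integral0_eq => y _; rewrite patchE in_setX (negbTE xA).
Qed.

Lemma integral_setX21 h : (m1 \x m2)%E.-integrable (A `*` B) h ->
  (\int[(m1 \x m2)%E]_(z in A `*` B) h z = \int[m2]_(y in B) \int[m1]_(x in A) h (x, y))%E.
Proof.
move=> /(integrable_mkcond _ (measurableX mA mB)) ih.
rewrite integral_mkcond -integral21_prod_meas1// [RHS]integral_mkcond.
apply: eq_integral => y _; rewrite /fubini_G patchE; case: ifPn => yB.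
  by rewrite [RHS]integral_mkcond; apply: eq_integral => x _;
    rewrite !patchE in_setX yB andbT.
by apply: integral0_eq => x _; rewrite patchE in_setX (negbTE yB) andbF.
Qed.

(** Tonelli's criterion, with [g] dominating the norms of the sections. Integrability of each
    section is what makes the bound by [g] meaningful: [fine +oo = 0] would hide a divergent
    section. *)
Lemma integrable_setX f (g : T1 -> R) : measurable_fun setT f ->
  (forall x, A x -> m2.-integrable B (fun y => (f (x, y))%:E)) ->
  (forall x, A x -> \int[m2]_(y in B) `|f (x, y)| <= g x) ->
  m1.-integrable A (EFin \o g) ->
  (m1 \x m2)%E.-integrable (A `*` B) (EFin \o f).
Proof.
move=> mf fi fg gi; apply/(integrable_mkcond _ (measurableX mA mB)).
have mr : measurable_fun setT ((EFin \o f) \_ (A `*` B)).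
  apply/(measurable_restrictT _ (measurableX mA mB)).
  by apply: measurable_funTS; exact/measurable_EFinP.
apply/integrable12ltyP => //.
rewrite (_ : (\int[m1]_x _)%E =
    (\int[m1]_(x in A) (\int[m2]_(y in B) `|f (x, y)|)%:E)%E); last first.
  rewrite [RHS]integral_mkcond; apply: eq_integral => x _.
  rewrite patchE; case: ifPn => xA.
    rewrite inE in xA; rewrite /Rintegral fineK; last first.
      apply: integrable_fin_num => //.
      exact: (integrable_norm (fi x xA)).
    rewrite [RHS]integral_mkcond; apply: eq_integral => y _.
    by rewrite !patchE in_setX mem_set//=; case: ifPn => //; rewrite abse0.
  by apply: integral0_eq => y _; rewrite patchE in_setX (negbTE xA) abse0.
move: gi => /integrableP[mg]; apply: le_lt_trans.
apply: ge0_le_integral => //.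
- by move=> x Ax; rewrite lee_fin; exact: Rintegral_ge0.
- apply/measurable_EFinP; apply: measurable_funTS.
  apply: (@measurable_section_Rintegral (fun z => `|f z|)).
  exact: measurableT_comp.
- exact: measurableT_comp.
- by move=> x Ax /=; rewrite lee_fin (le_trans (fg _ Ax))// ler_norm.
Qed.

Variable f : T1 * T2 -> R.
Hypotheses (mf : measurable_fun setT f)
  (fi : (m1 \x m2)%E.-integrable (A `*` B) (EFin \o f)).

Lemma Rintegral_setX12 :
  (forall x, A x -> m2.-integrable B (fun y => (f (x, y))%:E)) ->
  \int[(m1 \x m2)%E]_(z in A `*` B) f z = \int[m1]_(x in A) \int[m2]_(y in B) f (x, y).
Proof.
move=> f1; rewrite /Rintegral integral_setX12//; congr fine.
apply: eq_integral => x /[!inE] Ax; rewrite fineK//.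
by apply: integrable_fin_num => //; exact: f1.
Qed.

Lemma Rintegral_setX21 :
  (forall y, B y -> m1.-integrable A (fun x => (f (x, y))%:E)) ->
  \int[(m1 \x m2)%E]_(z in A `*` B) f z = \int[m2]_(y in B) \int[m1]_(x in A) f (x, y).
Proof.
move=> f1; rewrite /Rintegral integral_setX21//; congr fine.
apply: eq_integral => y /[!inE] By; rewrite fineK//.
by apply: integrable_fin_num => //; exact: f1.
Qed.

End rectangles.

(** * Affine and periodic changes of variables for nonnegative functions *)

Section affine_change_of_variables.
Context {R : realType}.
Local Notation mu := (@lebesgue_measure R).

Definition affine_map (a b : R) (x : measurableTypeR R) : measurableTypeR R := a * x + b.

Lemma measurable_affine_map a b : measurable_fun setT (affine_map a b).
Proof. by apply: measurable_funD => //; exact: measurable_funM. Qed.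

Lemma affine_map_preimage_itvoc (a b c d : R) : 0 < a ->
  affine_map a b @^-1` `]a * c + b, a * d + b] = `]c, d]%classic.
Proof.
move=> a0; apply/seteqP; split => x; rewrite /affine_map /= !in_itv/=;
  by rewrite ltrD2r lerD2r ltr_pM2l// ler_pM2l.
Qed.

(** The pushforward of [mu] by the affine map, rescaled by [a], agrees with [mu] on half-open
    intervals, hence everywhere by uniqueness of Lebesgue measure. *)
Lemma lebesgue_measure_affine (a b : R) (A : set R) : 0 < a -> measurable A ->
  mu (affine_map a b @^-1` A) = (a^-1%:E * mu A)%E.
Proof.
move=> a0 mA.
pose k : {nonneg R} := NngNum (ltW a0).
pose nu : {measure set (measurableTypeR R) -> \bar R} :=
  mscale k (pushforward mu (affine_map a b)).
suff -> : mu A = nu (measurable_affine_map a b) A.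
  by rewrite /= /mscale/= /pushforward muleA -EFinM mulVf ?gt_eqF// mul1e.
apply: lebesgue_measure_unique => //= _ [[c d] _ <-] /=.
rewrite /mscale/= /pushforward.
have e u : u = a * ((u - b) / a) + b by rewrite mulrC divfK ?gt_eqF// subrK.
rewrite {2}(e c) {2}(e d) affine_map_preimage_itvoc// !lebesgue_measure_itv/=.
rewrite !lte_fin ltr_pM2r ?invr_gt0// ltrD2r; case: ifPn => _; last by rewrite mule0.
by rewrite -!EFinD -EFinM; congr EFin; field; rewrite gt_eqF.
Qed.

Lemma ge0_integral_affine (F : R -> \bar R) (a b c d : R) : 0 < a ->
  measurable_fun setT F -> (forall x, 0 <= F x)%E ->
  (\int[mu]_(x in `]c, d]) F (a * x + b)%R =
   a^-1%:E * \int[mu]_(x in `](a * c + b)%R, (a * d + b)%R]) F x)%E.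
Proof.
move=> a0 mF F0.
rewrite -[in LHS](affine_map_preimage_itvoc b _ _ a0).
have -> : (\int[mu]_(x in affine_map a b @^-1` `](a * c + b)%R, (a * d + b)%R]) F (a * x + b)%R)%E =
    (\int[pushforward mu (affine_map a b)]_(x in `](a * c + b)%R, (a * d + b)%R]) F x)%E.
  rewrite ge0_integral_pushforward//; first exact: measurable_affine_map.
  exact: measurable_funTS.

have ai : 0 <= a^-1 by rewrite invr_ge0 ltW.
have := @ge0_integral_mscale _ _ _ mu `](a * c + b), (a * d + b)]%classic (measurable_itv _) (NngNum ai) F.
move=> <- //; last exact: measurable_funTS.
by apply: eq_measure_integral => [|mf A mA _]; [exact: measurable_affine_map|exact: lebesgue_measure_affine].
Qed.

Lemma ge0_integral_opp (F : R -> \bar R) (c d : R) :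
  measurable_fun setT F -> (forall x, 0 <= F x)%E ->
  (\int[mu]_(x in `]c, d]) F (- x)%R = \int[mu]_(x in `[(- d)%R, (- c)%R]) F x)%E.
Proof.
move=> mF F0.
rewrite -[RHS]integral_itv_bndo_bndc; last exact: measurable_funTS.
rewrite (_ : `]c, d]%classic =
    (-%R : _ -> measurableTypeR R) @^-1` `[- d, - c[%classic); last first.
  by rewrite opp_preimage_itvbndbnd/= !opprK.
rewrite -ge0_integral_pushforward//=; last exact: measurable_funTS.
by apply: eq_measure_integral => //= A mA _; exact: lebesgue_measureN.
Qed.

Lemma ge0_integral_itvoc_split (F : R -> \bar R) (a b c : R) : a <= b -> b <= c ->
  measurable_fun setT F -> (forall x, 0 <= F x)%E ->
  (\int[mu]_(x in `]a, c]) F x =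
   \int[mu]_(x in `]a, b]) F x + \int[mu]_(x in `]b, c]) F x)%E.
Proof.
move=> ab bc mF F0; rewrite -ge0_integral_setU//=.
- rewrite -itv_bndbnd_setU//.
- exact: measurable_funTS.
- apply/disj_setPS => x [] /=; rewrite !in_itv/= => /andP[_ xb] /andP[bx _].
  by move: (le_lt_trans xb bx); rewrite ltxx.
Qed.

(** The shifted window []s, 1 + s]] is cut at [1], and the piece beyond [1] is moved back to []0,
    s]] by periodicity. Half-open intervals make the pieces disjoint. *)
Lemma ge0_integral_period_shift (F : R -> \bar R) (s : R) : 0 <= s -> s <= 1 ->
  measurable_fun setT F -> (forall x, 0 <= F x)%E -> (forall x, F (x + 1)%R = F x) ->
  (\int[mu]_(x in `[0%R, 1%R]) F (x + s)%R = \int[mu]_(x in `[0%R, 1%R]) F x)%E.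
Proof.
move=> s0 s1 mF F0 F1.
have mFs : measurable_fun setT (fun x : R => F (x + s)%R).
  by apply: (measurableT_comp mF); exact: measurable_funD.
rewrite -!integral_itv_obnd_cbnd; [|exact: measurable_funTS..].
transitivity (\int[mu]_(x in `]0%R, 1%R]) F (1 * x + s)%R)%E.
  by apply: eq_integral => x _; rewrite mul1r.
rewrite (ge0_integral_affine s 0 1 ltr01)// invr1 mul1e mulr0 add0r mul1r.
rewrite (@ge0_integral_itvoc_split _ _ 1)//; last by rewrite lerDl.
rewrite [RHS](@ge0_integral_itvoc_split _ _ s)// addeC; congr (_ + _)%E.
transitivity (\int[mu]_(x in `]0%R, s]) F (1 * x + 1)%R)%E.
  rewrite (ge0_integral_affine 1 0 s ltr01)// invr1 mul1e mulr0 add0r mul1r.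
  by rewrite addrC.
by apply: eq_integral => x _; rewrite mul1r F1.
Qed.

(** The substitution covers two periods with weight [1/2]. *)
Lemma ge0_integral_period_double (F : R -> \bar R) :
  measurable_fun setT F -> (forall x, 0 <= F x)%E -> (forall x, F (x + 1)%R = F x) ->
  (\int[mu]_(x in `[0%R, 1%R]) F (2 * x)%R = \int[mu]_(x in `[0%R, 1%R]) F x)%E.
Proof.
move=> mF F0 F1.
have mFs : measurable_fun setT (fun x : R => F (2 * x)%R).
  by apply: (measurableT_comp mF); exact: measurable_funM.
rewrite -!integral_itv_obnd_cbnd; [|exact: measurable_funTS..].
transitivity (\int[mu]_(x in `]0%R, 1%R]) F (2 * x + 0)%R)%E.
  by apply: eq_integral => x _; rewrite addr0.
rewrite (ge0_integral_affine 0 0 1)// mulr0 !addr0 mulr1.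
rewrite (@ge0_integral_itvoc_split _ _ 1)//; [|by rewrite ler1n].
have -> : (\int[mu]_(x in `]1%R, 2%R]) F x = \int[mu]_(x in `]0%R, 1%R]) F x)%E.
  transitivity (\int[mu]_(x in `]0%R, 1%R]) F (1 * x + 1)%R)%E.
    rewrite (ge0_integral_affine 1 0 1 ltr01)// invr1 mul1e mulr0 add0r mul1r.
    by [].
  by apply: eq_integral => x _; rewrite mul1r F1.
rewrite -[X in (_ * (X + X))%E]mul1e -ge0_muleDl// muleA -EFinD -EFinM.
by rewrite mulVf ?mul1e.
Qed.

End affine_change_of_variables.

(** * Transfer from nonnegative test functions to signed integrals *)

Section equidistribution.
Context d1 d2 (T1 : measurableType d1) (T2 : measurableType d2) (R : realType).
Variables (m1 : {measure set T1 -> \bar R}) (m2 : {measure set T2 -> \bar R}).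

(* The image under [f1] of [m1] on [D1] is [c] times the image under [f2] of
   [m2] on [D2]. *)
Definition same_law (c : R) (D1 : set T1) (f1 : T1 -> R) (D2 : set T2) (f2 : T2 -> R) :=
  forall h : R -> R, measurable_fun setT h -> (forall r, 0 <= h r) ->
  (\int[m1]_(x in D1) (h (f1 x))%:E = c%:E * \int[m2]_(x in D2) (h (f2 x))%:E)%E.

Lemma same_law_comp c D1 f1 D2 f2 (g : R -> R) : measurable_fun setT g ->
  same_law c D1 f1 D2 f2 -> same_law c D1 (g \o f1) D2 (g \o f2).
Proof.
move=> mg L h mh h0; apply: (L (h \o g)) => [|r]; last exact: h0.
exact: measurableT_comp.
Qed.

Variables (c : R) (D1 : set T1) (f1 : T1 -> R) (D2 : set T2) (f2 : T2 -> R).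
Hypotheses (mD1 : measurable D1) (mD2 : measurable D2)
  (mf1 : measurable_fun D1 f1) (L : same_law c D1 f1 D2 f2).

Lemma same_law_integrable : m2.-integrable D2 (EFin \o f2) ->
  m1.-integrable D1 (EFin \o f1).
Proof.
move=> i2; apply/integrableP; split; first exact/measurable_EFinP.
rewrite (eq_integral (fun x => (`|f1 x|)%:E))// (L (h := fun r => `|r|))//.
have i2' := integrable_fin_num mD2 (integrable_norm i2).
by rewrite -(fineK i2') -EFinM ltry.
Qed.

(** The test functions [max r 0] and [max (- r) 0] match the positive and negative parts separately;
    integrability makes all four integrals finite, so that [fine] respects products and
    differences. *)
Lemma same_law_Rintegral : m2.-integrable D2 (EFin \o f2) ->
  \int[m1]_(x in D1) f1 x = c * \int[m2]_(x in D2) f2 x.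
Proof.
move=> i2; have i1 := same_law_integrable i2.
have split_pm d (T : measurableType d) (m : {measure set T -> \bar R}) D (f : T -> R) :
    measurable D -> m.-integrable D (EFin \o f) ->
    \int[m]_(x in D) f x =
      fine (\int[m]_(x in D) (Num.max (f x) 0)%:E) - fine (\int[m]_(x in D) (Num.max (- f x) 0)%:E).
  move=> mD fi; rewrite /Rintegral integralE fineB; last 2 first.
  - by apply: integrable_pos_fin_num.
  - by apply: integrable_neg_fin_num.
  by congr (fine _ - fine _); apply: eq_integral => x _;
    rewrite ?funeposE ?funenegE -EFin_max.
rewrite !split_pm// (L (h := fun r => Num.max r 0)); last 2 first.
- exact: measurable_maxr.
- by move=> r; rewrite le_max lexx orbT.
rewrite (L (h := fun r => Num.max (- r) 0)); last 2 first.
- by apply: measurable_maxr => //; exact: measurable_funN.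
- by move=> r; rewrite le_max lexx orbT.
rewrite !fineM//; first by rewrite mulrBr.
- rewrite (eq_integral (EFin \o f2)^\-%E); last by move=> x _; rewrite funenegE -EFin_max.
  by apply: integrable_neg_fin_num.
- rewrite (eq_integral (EFin \o f2)^\+%E); last by move=> x _; rewrite funeposE -EFin_max.
  by apply: integrable_pos_fin_num.
Qed.

End equidistribution.

(** * The log-sine function and the comparison with an inverse square root *)

Section log_sine.
Context {R : realType}.
Local Notation mu := (@lebesgue_measure R).

(** The function [G] of the overview, extended to an even function by the absolute value. At its
    singularity [th = 0] it takes the value [ln 0 = 0], which breaks monotonicity there. *)
Definition logsin (th : R) : R := ln `|2 * sin (th / 2)|.

Lemma measurable_sin : measurable_fun setT (@sin R).
Proof. by apply: continuous_measurable_fun; exact: continuous_sin. Qed.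

Lemma measurable_cos : measurable_fun setT (@cos R).
Proof. by apply: continuous_measurable_fun; exact: continuous_cos. Qed.

Lemma measurable_logsin : measurable_fun setT logsin.
Proof.
apply: (measurableT_comp (@measurable_ln R)); apply: measurableT_comp => //.
apply: measurable_funM => //; apply: (measurableT_comp measurable_sin).
exact: measurable_funM.
Qed.

Lemma logsin_even th : logsin (- th) = logsin th.
Proof. by rewrite /logsin mulNr sinN mulrN normrN. Qed.

(** On [[0, 1]] the mean value theorem gives [sin x >= cos 1 * x]. Beyond [1],
    [sin x >= sin 1 >= cos 1], and the factor [1/2] absorbs [x <= pi / 2 < 2]. *)
Lemma sin_lower_bound (x : R) : 0 <= x -> x <= pi / 2 -> (cos 1 : R) / 2 * x <= sin x.
Proof.
move=> x0 xpi; have c0 : 0 < cos 1 :> R by exact: cos1_gt0.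
have p1 := @pihalf_ge1 R; have p2 := @pihalf_lt2 R; have p0 := @pi_ge2 R.
have mvt (y : R) : 0 < y -> y <= 1 -> @cos R 1 * y <= @sin R y.
  move=> y0 y1; have [] := @MVT R (@sin R) (@cos R) 0 y y0.
    by apply: continuous_subspaceT => z; exact: continuous_sin.
  move=> z; rewrite in_itv/= => /andP[z0 zy]; rewrite sin0 !subr0 => ->.
  rewrite ler_pM2r//; have := @ltr_cos R z 1; rewrite !in_itv/= => h.
  by apply: ltW; rewrite h ?ler01 ?andbT//; [lra|apply/andP; split; lra|lra].
have [x1|x1] := leP x 1.
  have [->|xn0] := eqVneq x 0; first by rewrite mulr0 sin0.
  have xp : 0 < x by rewrite lt_neqAle eq_sym xn0.
  by apply: le_trans (mvt x xp x1); rewrite ler_pM2r//; lra.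
have s1 := mvt 1 ltr01 (lexx _).
have : sin 1 <= sin x :> R.
  apply: ltW; rewrite ltr_sin// !in_itv/=; apply/andP; split; lra.
by nra.
Qed.

(** The integrand is [x^(-1/2)], with primitive [2 * sqrt x] written through [expR] and [ln]. The
    fundamental theorem is applied on intervals away from [0], with a bound uniform in [i], and
    monotone convergence concludes. *)
Lemma integral_inv_sqrt_lty (c : R) : 0 < c ->
  (\int[mu]_(x in `]0%R, c]) (expR (- (ln x / 2)))%:E < +oo)%E.
Proof.
move=> c0; pose f x : R := expR (- (ln x / 2)).
pose F (i : nat) : set R := `[i.+1%:R^-1, c]%classic.
have FE : \bigcup_i F i = `]0, c]%classic.
  apply/seteqP; split => x /=.
    move=> [i _]; rewrite /F/= !in_itv/= => /andP[ix ->]; rewrite andbT.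
    by rewrite (lt_le_trans _ ix)// invr_gt0.
  rewrite in_itv/= => /andP[x0 xc]; exists (Num.truncn x^-1) => //.
  rewrite /F/= in_itv/= xc andbT -[leRHS]invrK lef_pV2 ?posrE ?invr_gt0//.
  by rewrite ltW// truncnS_gt.
have ndF : nondecreasing_seq F.
  apply/nondecreasing_seqP => n; apply/subsetPset => x.
  rewrite /F/= !in_itv/= => /andP[nx ->]; rewrite andbT (le_trans _ nx)//.
  by rewrite lef_pV2 ?posrE// ler_nat.
have mf : measurable_fun setT f.
  apply: (measurableT_comp (@measurable_expR R)); apply: measurable_funN.
  by apply: measurable_funM => //; exact: measurable_ln.
have cvg : ((\int[mu]_(x in F i) (f x)%:E)%E @[i --> \oo] -->
    (\int[mu]_(x in `]0%R, c]) (f x)%:E)%E).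
  rewrite -FE; apply: ge0_nondecreasing_set_cvg_integral => //.
  - by move=> i; exact: measurable_itv.
  - by move=> i; apply: measurable_funTS; exact/measurable_EFinP.
  - by move=> i x _; rewrite lee_fin expR_ge0.
have bnd i : (\int[mu]_(x in F i) (f x)%:E <= (2 * expR (ln c / 2))%:E)%E.
  (* For small [i] the interval has at most one point, and its integral is [0]. *)
  have [ic|ci] := ltP i.+1%:R^-1 c; last first.
    rewrite (@integral_Sset1 _ _ _ c); last first.
      by move=> x; rewrite /F/= in_itv/= => /andP[? ?]; apply/eqP;
        rewrite eq_le (le_trans ci)// andbT.
    by rewrite lee_fin mulr_ge0// expR_ge0.
  have i0 : 0 < i.+1%:R^-1 :> R by rewrite invr_gt0.
  have D (x : R) : 0 < x -> is_derive x 1 (fun x : R => 2 * expR (ln x / 2)) (f x).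
    move=> x0; have dl := is_derive1_ln x0.
    have e : x = expR (ln x / 2) * expR (ln x / 2).
      by rewrite -expRD -splitr lnK.
    apply: is_derive_eq; rewrite /GRing.scale/= /f expRN.
    have := expR_gt0 (ln x / 2); move: (expR (ln x / 2)) e => w -> w0.
    by field; rewrite gt_eqF.
  have cF (x : R) : 0 < x -> {for x, continuous (fun x : R => 2 * expR (ln x / 2))}.
    by move=> x0; apply/differentiable_continuous/derivable1_diffP; case: (D x x0).
  have cf (x : R) : 0 < x -> {for x, continuous f}.
    move=> x0; apply: (continuous_comp (g := expR)); last exact: continuous_expR.
    apply: continuousN; apply: continuousM; first exact: continuous_ln.
    exact: cst_continuous.
  rewrite (@continuous_FTC2 _ f (fun x : R => 2 * expR (ln x / 2)))//.
  - by rewrite lee_fin lerBlDr lerDl mulr_ge0// expR_ge0.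
  - apply: continuous_in_subspaceT => x; rewrite inE/= in_itv/= => /andP[ix _].
    by apply: cf; exact: lt_le_trans ix.
  - split.
    + move=> x; rewrite in_itv/= => /andP[ix _].
      by case: (D x (lt_trans i0 ix)).
    + by apply: cvg_at_right_filter; exact: cF.
    + by apply: cvg_at_left_filter; exact: cF.
  - move=> x; rewrite in_itv/= => /andP[ix _]; rewrite derive1E.
    by case: (D x (lt_trans i0 ix)).
apply: le_lt_trans (ltry (2 * expR (ln c / 2))).
rewrite -(cvg_lim _ cvg)//.
apply: lime_le; last by near=> i; exact: bnd.
by apply/cvg_ex; eexists; exact: cvg.
Unshelve. all: by end_near. Qed.

End log_sine.

Section log_sine_integrability.
Context {R : realType}.
Local Notation mu := (@lebesgue_measure R).

Lemma integrable_obnd_cbnd (a b : R) (f : R -> R) : measurable_fun setT f ->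
  mu.-integrable `]a, b] (EFin \o f) -> mu.-integrable `[a, b] (EFin \o f).
Proof.
move=> mf /integrableP[_]; rewrite integral_itv_obnd_cbnd => [fi|]; last first.
  by apply: measurableT_comp => //; apply/measurable_EFinP; exact: measurable_funTS.
by apply/integrableP; split => //; apply/measurable_EFinP; exact: measurable_funTS.
Qed.

(** From [t^n <= n! * exp t] at [t = |s| / 2]. The halved exponent is the point: any power of a
    logarithm costs at most a singularity of order [1/2], which is integrable. *)
Lemma normr_exprn_le_expR (n : nat) (s : R) :
  `|s| ^+ n <= 2 ^+ n * n`!%:R * expR (`|s| / 2).
Proof.
have e1 (t : R) : 0 <= t -> t ^+ n <= n`!%:R * expR t.
  move=> t0; case: n => [|n]; first by rewrite expr0 fact0 mul1r (le_trans _ (expR_ge1Dx t))// lerDl.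
  rewrite -ler_pdivrMl ?ltr0n ?fact_gt0//; apply: le_trans (expR_ge1Dxn n t0).
  by rewrite mulrC lerDr.
have -> : `|s| ^+ n = 2 ^+ n * (`|s| / 2) ^+ n.
  by rewrite -exprMn mulrC divfK.
by rewrite -mulrA ler_wpM2l// e1// divr_ge0.
Qed.

(** The first summand covers [logsin th >= 0], where [2 * sin (th / 2) <= 2]; the second covers
    [logsin th < 0], where [2 * sin (th / 2) >= cos 1 / 2 * th]. *)
Lemma logsin_norm_bound (th : R) : 0 < th -> th <= pi ->
  expR (`|logsin th| / 2) <=
  expR (ln 2 / 2) + expR (- (ln (cos 1 / 2) / 2)) * expR (- (ln th / 2)).
Proof.
move=> t0 tpi; have c0 : 0 < cos 1 :> R by exact: cos1_gt0.
have sb : cos 1 / 2 * (th / 2) <= sin (th / 2).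
  by apply: sin_lower_bound; lra.
have s1 := sin_le1 (th / 2).
have cth : 0 < cos 1 / 2 * th by rewrite mulr_gt0// divr_gt0.
have u0 : 0 < 2 * sin (th / 2) by lra.
rewrite /logsin (gtr0_norm u0); set u := 2 * _ in u0 *.
have l1 : ln u <= ln 2 by rewrite ler_ln ?posrE// /u; lra.
have l2 : ln (cos 1 / 2) + ln th <= ln u.
  by rewrite -lnM ?posrE ?divr_gt0// ler_ln ?posrE// /u; lra.
have [lu|lu] := leP 0 (ln u).
  apply: (@le_trans _ _ (expR (ln 2 / 2))); first by rewrite ler_expR ger0_norm//; lra.
  by rewrite lerDl mulr_ge0// expR_ge0.
rewrite ltr0_norm// ler_wpDl ?expR_ge0// -expRD ler_expR; lra.
Qed.

Lemma integrable_logsin_exp n :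
  mu.-integrable `[0, pi] (fun th => ((logsin th) ^+ n)%:E).
Proof.
have mG : measurable_fun setT (fun th : R => logsin th ^+ n).
  exact: measurable_funX measurable_logsin.
apply: (integrable_obnd_cbnd mG).
have mh : measurable_fun setT (fun x : R => expR (- (ln x / 2))).
  apply: (measurableT_comp (@measurable_expR R)); apply: measurable_funN.
  by apply: measurable_funM => //; exact: measurable_ln.
have ih : mu.-integrable `]0, pi] (fun x => (expR (- (ln x / 2)))%:E).
  apply/integrableP; split; first by apply/measurable_EFinP; exact: measurable_funTS.
  apply: le_lt_trans (integral_inv_sqrt_lty (@pi_gt0 R)).
  rewrite le_eqVlt; apply/orP; left; apply/eqP; apply: eq_integral => x _ /=.
  by rewrite ger0_norm// expR_ge0.
have ic (c : R) : mu.-integrable `]0, pi] (fun=> c%:E).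
  apply/integrableP; split => //; rewrite integral_cst//= lebesgue_measure_itv/=.
  by rewrite lte_fin pi_gt0 -EFinD -EFinM ltry.
pose c1 : R := 2 ^+ n * n`!%:R.
apply: (@le_integrable _ _ _ mu _ _ _ (fun x =>
    (c1 * expR (ln 2 / 2))%:E +
    (c1 * expR (- (ln (cos 1 / 2) / 2)))%:E * (expR (- (ln x / 2)))%:E)%E) => //.
- by apply/measurable_EFinP; exact: measurable_funTS.
- move=> x; rewrite /= in_itv/= => /andP[x0 xpi].
  rewrite lee_fin normrX (le_trans (normr_exprn_le_expR _ _))//.
  apply: le_trans (ler_norm _); rewrite -/c1 -[X in _ + X]mulrA -mulrDr ler_wpM2l//.
    by rewrite mulr_ge0// exprn_ge0.
  exact: logsin_norm_bound.
- by apply: integrableD => //; exact: integrableZl.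
Qed.

Lemma same_law_period_shift (f : R -> R) (s : R) : 0 <= s -> s <= 1 ->
  measurable_fun setT f -> (forall x, f (x + 1) = f x) ->
  same_law mu mu 1 `[0, 1] (fun x => f (x + s)) `[0, 1] f.
Proof.
move=> s0 s1 mf f1 h mh h0; rewrite mul1e.
apply: (ge0_integral_period_shift (F := EFin \o (h \o f))) => //=.
- by apply/measurable_EFinP; exact: measurableT_comp.
- by move=> x; rewrite lee_fin.
- by move=> x; rewrite f1.
Qed.

Lemma same_law_period_double (f : R -> R) :
  measurable_fun setT f -> (forall x, f (x + 1) = f x) ->
  same_law mu mu 1 `[0, 1] (fun x => f (2 * x)) `[0, 1] f.
Proof.
move=> mf f1 h mh h0; rewrite mul1e.
apply: (ge0_integral_period_double (F := EFin \o (h \o f))) => //=.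
- by apply/measurable_EFinP; exact: measurableT_comp.
- by move=> x; rewrite lee_fin.
- by move=> x; rewrite f1.
Qed.

(** The substitution sends [[0, 1]] to [[- pi, pi]] with weight [1 / (2 * pi)]; evenness folds this
    onto [[0, pi]] and doubles the weight. *)
Lemma same_law_logsin (f : R -> R) : (forall t, f t = logsin (2 * pi * t - pi)) ->
  same_law mu mu pi^-1 `[0, 1] f `[0, pi] logsin.
Proof.
move=> fE h mh h0; pose F := EFin \o (h \o @logsin R).
have mF : measurable_fun setT F.
  by apply/measurable_EFinP; apply: measurableT_comp => //; exact: measurable_logsin.
have F0 x : (0 <= F x)%E by rewrite lee_fin /=; exact: h0.
have p0 : 0 < pi :> R by exact: pi_gt0.
have p20 : 0 < 2 * pi :> R by rewrite mulr_gt0.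
have mf : measurable_fun setT f.
  rewrite (_ : f = @logsin R \o (fun t => 2 * pi * t - pi)); last exact/funext.
  apply: (measurableT_comp measurable_logsin).
  by apply: measurable_funB => //; exact: measurable_funM.
rewrite -integral_itv_obnd_cbnd; last first.
  by apply: measurable_funTS; apply/measurable_EFinP; exact: measurableT_comp.
transitivity (\int[mu]_(x in `]0%R, 1%R]) F (2 * pi * x + - pi)%R)%E.
  by apply: eq_integral => x _; rewrite /F/= fE.
rewrite (ge0_integral_affine (- pi) 0 1 p20)//.
rewrite (_ : 2 * pi * 0 + - pi = - pi); last by rewrite mulr0 add0r.
rewrite (_ : 2 * pi * 1 + - pi = pi); last by ring.
rewrite (@ge0_integral_itvoc_split _ _ _ 0)// ?oppr_le0 ?ltW//.
have -> : (\int[mu]_(x in `](- pi)%R, 0%R]) F x = \int[mu]_(x in `[0%R, pi]) F x)%E.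
  rewrite -[X in _ = (\int[mu]_(x in [set` Interval _ (BRight X)]) _)%E]opprK.
  rewrite -[X in _ = (\int[mu]_(x in [set` Interval (BLeft X) _]) _)%E]oppr0.
  rewrite -ge0_integral_opp//; apply: eq_integral => x _.
  by rewrite /F/= logsin_even.
rewrite integral_itv_obnd_cbnd; last exact: measurable_funTS.
rewrite -[X in (_ * (X + X))%E]mul1e -ge0_muleDl// muleA -EFinD -EFinM.
by congr (_%:E * _)%E; move: (@pi R) p0 => q q0; field; rewrite gt_eqF.
Qed.

End log_sine_integrability.

(** * The parametrized unit circle *)

Section unit_circle.
Context {R : realType}.
Local Notation mu := (@lebesgue_measure R).
Local Notation normc := (@Normc.normc R).
Local Notation e := (@expi2pi R).
Implicit Types (c x y : R[i]) (s t : R).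

Lemma normcN x : normc (- x) = normc x.
Proof. by case: x => a b /=; rewrite !sqrrN. Qed.

Lemma normc_ge0 x : 0 <= normc x.
Proof. by case: x => a b /=; exact: sqrtr_ge0. Qed.

Lemma normc_gt0 x : (0 < normc x) = (x != 0).
Proof.
rewrite lt_neqAle normc_ge0 andbT eq_sym; congr (~~ _).
apply/eqP/eqP => [/Normc.eq0_normc//|->]; exact: Normc.normc0.
Qed.

Lemma ler_normcD x y : normc (x + y) <= normc x + normc y.
Proof.
have := ler_normD x y; rewrite /Num.norm/= -rmorphD/= lecR; exact.
Qed.

Lemma ln_normcM x y : x != 0 -> y != 0 ->
  ln (normc (x * y)) = ln (normc x) + ln (normc y).
Proof. by move=> x0 y0; rewrite Normc.normcM lnM// posrE normc_gt0. Qed.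

Lemma expi2piD s t : e (s + t) = e s * e t.
Proof.
rewrite /expi2pi mulrDr cosD sinD; apply/eqP; rewrite eq_complex/=.
by rewrite eqxx/= addrC.
Qed.

Lemma normc_expi2pi t : normc (e t) = 1.
Proof. by rewrite /= cos2Dsin2 sqrtr1. Qed.

Lemma expi2pi_neq0 t : e t != 0.
Proof. by rewrite -normc_gt0 normc_expi2pi. Qed.

Lemma expi2pi1 : e 1 = 1.
Proof.
rewrite /expi2pi mulr1 mulr_natl cos2pi sin2pi.
by apply/eqP; rewrite eq_complex/= !eqxx.
Qed.

Lemma expi2pi_half : e 2^-1 = -1.
Proof.
rewrite /expi2pi mulrAC divff// mul1r cospi sinpi.
by apply/eqP; rewrite eq_complex/= oppr0 !eqxx.
Qed.

Lemma expi2pi_Dhalf t : e (t + 2^-1) = - e t.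
Proof. by rewrite expi2piD expi2pi_half mulrN1. Qed.

Lemma expi2pi_period t : e (t + 1) = e t.
Proof. by rewrite expi2piD expi2pi1 mulr1. Qed.

Lemma expi2pi_double t : e (2 * t) = e t * e t.
Proof. by rewrite -expi2piD; congr expi2pi; ring. Qed.

(** Both arguments of [ln] equal [2 * |cos (pi * t)|], by the double-angle formulas on the left and
    a quarter-turn on the right. *)
Lemma ln_normc_add1_expi2pi t : ln (normc (1 + e t)) = logsin (2 * pi * t - pi).
Proof.
rewrite /logsin; congr ln; rewrite -sqrtr_sqr /=; congr Num.sqrt.
have -> : (2 * pi * t - pi) / 2 = pi * t - pi / 2 by field.
rewrite sinBpihalf; have -> : 2 * pi * t = (pi * t) *+ 2 by rewrite mulr2n; ring.
rewrite cos_mulr2n sin_mulr2n.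
have := cos2Dsin2 (pi * t); move: (cos _) (sin _) => u v uv.
rewrite !mulr2n; transitivity (4 * u ^+ 2 * (u ^+ 2 + v ^+ 2)); first by ring.
by rewrite uv; ring.
Qed.

Lemma expi2pi_eqN1 t : 0 <= t -> t <= 1 -> 1 + e t = 0 -> t = 2^-1.
Proof.
move=> t0 t1 /(congr1 (@complex.Re R)) /= h.
have p0 : 0 < pi :> R by exact: pi_gt0.
have : cos (pi * t) = cos (pi / 2).
  have : 2 * pi * t = (pi * t) *+ 2 by rewrite mulr2n; ring.
  move=> hh; rewrite hh cos_mulr2n in h.
  have : cos (pi * t) ^+ 2 = 0 by move: h; rewrite mulr2n; lra.
  by move/eqP; rewrite sqrf_eq0 => /eqP ->; rewrite cos_pihalf.
move/cos_inj; rewrite !in_itv/=.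
have tp : pi * t <= pi by rewrite ger_pMr.
rewrite mulr_ge0 ?(ltW p0)//= tp divr_ge0 ?(ltW p0)//= => /(_ isT).
rewrite ler_pdivrMr// ler_peMr ?ler1n ?(ltW p0)// => /(_ isT) /(mulfI _); apply.
by rewrite gt_eqF.
Qed.

Lemma expi2pi_eq1 t : 0 < t -> t < 1 -> 1 - e t != 0.
Proof.
move=> t0 t1; apply/eqP => /(congr1 (@complex.Re R)) /=.
have p0 : 0 < pi :> R by exact: pi_gt0.
have -> : 2 * pi * t = (pi * t) *+ 2 by rewrite mulr2n; ring.
rewrite cos_mulr2n => h.
have : 0 < sin (pi * t) by apply: sin_gt0_pi; rewrite mulr_gt0//= gtr_pMr.
have := cos2Dsin2 (pi * t); move: h; rewrite mulr2n; move: (cos _) (sin _) => u v.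
nra.
Qed.

(** The arccosine of the real part gives the upper half circle; for the lower half the angle is
    negated and one full turn is added, to stay in [[0, 1]]. *)
Lemma expi2pi_surj c : normc c = 1 -> exists s, [/\ 0 <= s, s <= 1 & c = e s].
Proof.
case: c => a b /= h; have ab : a ^+ 2 + b ^+ 2 = 1.
  by rewrite -[LHS]sqr_sqrtr ?h ?expr1n// addr_ge0 ?sqr_ge0.
have p0 : 0 < pi :> R by exact: pi_gt0.
have a1 : -1 <= a <= 1.
  rewrite -ler_norml -(@ler_pXn2r _ 2)// ?nnegrE// expr1n.
  by rewrite real_normK ?num_real// -ab lerDl sqr_ge0.
have ac := acosK a1; have as' := sin_acos a1.
have c0 := acos_ge0 a1; have cp := acos_lepi a1.
have bE : `|b| = sin (acos a).
  by rewrite as' -sqrtr_sqr; congr Num.sqrt; rewrite -ab; ring.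
have [b0|b0] := leP 0 b.
  exists (acos a / (2 * pi)); split.
  - by rewrite divr_ge0// mulr_ge0// ltW.
  - by rewrite ler_pdivrMr ?mulr_gt0// mul1r; lra.
  rewrite /expi2pi mulrC divfK ?mulf_neq0 ?gt_eqF// ac -bE ger0_norm//.
exists (1 - acos a / (2 * pi)); split.
- by rewrite subr_ge0 ler_pdivrMr ?mulr_gt0// mul1r; lra.
- by rewrite lerBlDr lerDl divr_ge0// mulr_ge0// ltW.
have -> : e (1 - acos a / (2 * pi)) = e (- (acos a / (2 * pi))).
  by rewrite addrC expi2pi_period.
rewrite /expi2pi mulrN [2 * pi * _]mulrC divfK ?mulf_neq0 ?gt_eqF//.
by rewrite cosN sinN ac -bE ltr0_norm// opprK.
Qed.

End unit_circle.

Section complex_measurability.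
Context d (T : measurableType d) (R : realType).
Implicit Types w : T -> R[i].

Definition cmeasurable w := measurable_fun setT (fun t => complex.Re (w t)) /\
  measurable_fun setT (fun t => complex.Im (w t)).

Lemma cmeasurable_cst c : cmeasurable (fun=> c).
Proof. by split; exact: measurable_cst. Qed.

Lemma cmeasurableD w1 w2 : cmeasurable w1 -> cmeasurable w2 ->
  cmeasurable (fun t => w1 t + w2 t).
Proof.
move=> [r1 i1] [r2 i2]; split.
  rewrite (_ : (fun t => _) = (fun t => complex.Re (w1 t) + complex.Re (w2 t))).
    exact: measurable_funD.
  by apply/funext => t; case: (w1 t) => ? ?; case: (w2 t).
rewrite (_ : (fun t => _) = (fun t => complex.Im (w1 t) + complex.Im (w2 t))).
  exact: measurable_funD.
by apply/funext => t; case: (w1 t) => ? ?; case: (w2 t).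
Qed.

Lemma cmeasurableM w1 w2 : cmeasurable w1 -> cmeasurable w2 ->
  cmeasurable (fun t => w1 t * w2 t).
Proof.
move=> [r1 i1] [r2 i2]; split.
  rewrite (_ : (fun t => _) = (fun t => complex.Re (w1 t) * complex.Re (w2 t) -
      complex.Im (w1 t) * complex.Im (w2 t))).
    by apply: measurable_funB; exact: measurable_funM.
  by apply/funext => t; case: (w1 t) => ? ?; case: (w2 t).
rewrite (_ : (fun t => _) = (fun t => complex.Re (w1 t) * complex.Im (w2 t) +
    complex.Im (w1 t) * complex.Re (w2 t))).
  by apply: measurable_funD; exact: measurable_funM.
by apply/funext => t; case: (w1 t) => ? ?; case: (w2 t).
Qed.

Lemma cmeasurable_expi2pi (g : T -> R) : measurable_fun setT g ->
  cmeasurable (fun t => expi2pi (g t)).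
Proof.
move=> mg; split.
  by apply: (measurableT_comp measurable_cos); exact: measurable_funM.
by apply: (measurableT_comp measurable_sin); exact: measurable_funM.
Qed.

Lemma measurable_ln_normc w : cmeasurable w ->
  measurable_fun setT (fun t => ln (Normc.normc (w t))).
Proof.
move=> [r i]; apply: (measurableT_comp (@measurable_ln R)).
rewrite (_ : (fun t => _) = (fun t => Num.sqrt (complex.Re (w t) ^+ 2 + complex.Im (w t) ^+ 2))).
  apply: (@measurableT_comp _ _ _ _ _ _ (@Num.sqrt R)).
    by apply: continuous_measurable_fun; exact: sqrt_continuous.
  by apply: measurable_funD; exact: measurable_funX.
by apply/funext => t; case: (w t).
Qed.

End complex_measurability.

(** * Mean value of [ln |1 + c z|] inside the unit disk *)

Section jensen.
Context {R : realType}.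
Local Notation mu := (@lebesgue_measure R).
Local Notation normc := (@Normc.normc R).
Local Notation e := (@expi2pi R).
Implicit Types (c : R[i]) (f g : R -> R).

Lemma integrable_period_shift f (s : R) : 0 <= s -> s <= 1 ->
  measurable_fun setT f -> (forall x, f (x + 1) = f x) ->
  mu.-integrable `[0, 1] (EFin \o f) ->
  mu.-integrable `[0, 1] (fun x => (f (x + s))%:E).
Proof.
move=> s0 s1 mf f1 fi.
apply: (@same_law_integrable _ _ _ _ R mu mu 1 `[0, 1] (fun x => f (x + s)) `[0, 1] f) => //;
  last exact: same_law_period_shift.
by apply: measurable_funTS; apply: (measurableT_comp mf); exact: measurable_funD.
Qed.

Lemma Rintegral_period_shift f (s : R) : 0 <= s -> s <= 1 ->
  measurable_fun setT f -> (forall x, f (x + 1) = f x) ->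
  mu.-integrable `[0, 1] (EFin \o f) ->
  \int[mu]_(x in `[0, 1]) f (x + s) = \int[mu]_(x in `[0, 1]) f x.
Proof.
move=> s0 s1 mf f1 fi; rewrite -[RHS]mul1r.
apply: (@same_law_Rintegral _ _ _ _ R mu mu 1 `[0, 1] (fun x => f (x + s)) `[0, 1] f) => //;
  last exact: same_law_period_shift.
by apply: measurable_funTS; apply: (measurableT_comp mf); exact: measurable_funD.
Qed.

Lemma Rintegral_period_double f :
  measurable_fun setT f -> (forall x, f (x + 1) = f x) ->
  mu.-integrable `[0, 1] (EFin \o f) ->
  \int[mu]_(x in `[0, 1]) f (2 * x) = \int[mu]_(x in `[0, 1]) f x.
Proof.
move=> mf f1 fi; rewrite -[RHS]mul1r.
apply: (@same_law_Rintegral _ _ _ _ R mu mu 1 `[0, 1] (fun x => f (2 * x)) `[0, 1] f) => //;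
  last exact: same_law_period_double.
by apply: measurable_funTS; apply: (measurableT_comp mf); exact: measurable_funM.
Qed.

Lemma integrable_itv_cst (a b k : R) : mu.-integrable `[a, b] (fun=> k%:E).
Proof.
apply/integrableP; split => //; rewrite integral_cst//= lebesgue_measure_itv/=.
by case: ifPn => _; rewrite ?mule0// -EFinD -EFinM ltry.
Qed.

Lemma Rintegral01_cst (k : R) : \int[mu]_(x in `[0, 1]) k = k.
Proof.
by rewrite Rintegral_cst//= lebesgue_measure_itv/= lte_fin ltr01 oppr0 addr0 mulr1.
Qed.

Lemma integrable_itv_bounded (a b k : R) f : measurable_fun setT f ->
  (forall x, `|f x| <= k) -> mu.-integrable `[a, b] (EFin \o f).
Proof.
move=> mf fk; apply: (@le_integrable _ _ _ mu _ _ _ (fun=> k%:E)) => //.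
- by apply/measurable_EFinP; exact: measurable_funTS.
- by move=> x _; rewrite lee_fin (le_trans (fk x))// ler_norm.
- exact: integrable_itv_cst.
Qed.

(** Used to skip the parameters where [ln 0 = 0] spoils an identity. *)
Lemma eq_Rintegral_countable (D S : set R) f g : measurable D -> countable S ->
  measurable_fun setT f -> measurable_fun setT g ->
  (forall x, D x -> ~ S x -> f x = g x) ->
  \int[mu]_(x in D) f x = \int[mu]_(x in D) g x.
Proof.
move=> mD cS mf mg fg; congr fine; apply: ae_eq_integral => //.
- by apply/measurable_EFinP; exact: measurable_funTS.
- by apply/measurable_EFinP; exact: measurable_funTS.
exists S; split.
- exact: countable_measurable.
- exact: countable_lebesgue_measure0.
- move=> x /= h; apply: contrapT => Sx; apply: h => Dx; congr EFin; exact: fg.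
Qed.

(** On the circle [1 - |c| <= |1 + c z| <= 2]; as [ln 2] and [- ln (1 - |c|)] are both nonnegative,
    their sum bounds either sign. *)
Lemma ln_normc_bounds c t : normc c < 1 ->
  `|ln (normc (1 + c * e t))| <= ln 2 - ln (1 - normc c).
Proof.
move=> c1; have c0 := normc_ge0 c.
have nce : normc (c * e t) = normc c by rewrite Normc.normcM normc_expi2pi mulr1.
have up : normc (1 + c * e t) <= 2.
  by have := ler_normcD 1 (c * e t); rewrite nce Normc.normc1; lra.
have lo : 1 - normc c <= normc (1 + c * e t).
  have := ler_normcD (1 + c * e t) (- (c * e t)).
  by rewrite addrK normcN nce Normc.normc1; lra.
have p0 : 0 < normc (1 + c * e t) by lra.
have l1 : ln (normc (1 + c * e t)) <= ln 2 by rewrite ler_ln// posrE; lra.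
have l2 : ln (1 - normc c) <= ln (normc (1 + c * e t)) by rewrite ler_ln// posrE; lra.
have l3 : ln (1 - normc c) <= 0 by apply: ln_le0; lra.
have l4 : 0 <= ln 2 :> R by apply: ln_ge0; lra.
by rewrite ler_norml; apply/andP; split; lra.
Qed.

Lemma measurable_ln_normc_circle (a b : R[i]) :
  measurable_fun setT (fun t => ln (normc (a + b * e t))).
Proof.
apply: measurable_ln_normc; apply: cmeasurableD; first exact: cmeasurable_cst.
by apply: cmeasurableM; [exact: cmeasurable_cst|exact: cmeasurable_expi2pi].
Qed.

Lemma integrable_disk c : normc c < 1 ->
  mu.-integrable `[0, 1] (fun t => (ln (normc (1 + c * e t)))%:E).
Proof.
move=> c1; apply: integrable_itv_bounded; first exact: measurable_ln_normc_circle.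
by move=> t; exact: ln_normc_bounds.
Qed.

Lemma normc_disk_neq0 c t : normc c < 1 -> 1 + c * e t != 0.
Proof.
move=> c1; apply/eqP => /(congr1 (fun z => z - c * e t)); rewrite addrK sub0r => h.
have := congr1 normc h.
by rewrite normcN Normc.normcM normc_expi2pi mulr1 Normc.normc1 => n1; rewrite -n1 ltxx in c1.
Qed.

(* (1 + z)(1 - z) = 1 - z^2. *)
Lemma Rintegral_disk_double c : normc c < 1 ->
  \int[mu]_(t in `[0, 1]) ln (normc (1 + - (c * c) * e t)) =
  2 * \int[mu]_(t in `[0, 1]) ln (normc (1 + c * e t)).
Proof.
move=> c1; have cc1 : normc (- (c * c)) < 1.
  by rewrite normcN Normc.normcM; have := normc_ge0 c; nra.
have cN1 : normc (- c) < 1 by rewrite normcN.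
have per a b t : ln (normc (a + b * e (t + 1))) = ln (normc (a + b * e t)).
  by rewrite expi2pi_period.
rewrite -(Rintegral_period_double (measurable_ln_normc_circle 1 (- (c * c)))) //;
  last exact: integrable_disk.
(* Changing the sign of [c] is a half-turn of the circle. *)
have eN : \int[mu]_(t in `[0, 1]) ln (normc (1 + - c * e t)) =
    \int[mu]_(t in `[0, 1]) ln (normc (1 + c * e t)).
  rewrite -(@Rintegral_period_shift (fun t => ln (normc (1 + c * e t))) 2^-1)//.
  - by apply: eq_Rintegral => t _; rewrite expi2pi_Dhalf mulrN mulNr.
  - by rewrite invf_le1// ler1n.
  - exact: measurable_ln_normc_circle.
  - exact: integrable_disk.
rewrite mulr_natl mulr2n -[X in _ = X + _]eN.
rewrite -RintegralD//; try exact: integrable_disk.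
apply: eq_Rintegral => t _; rewrite -ln_normcM ?normc_disk_neq0//.
by congr (ln (normc _)); rewrite expi2pi_double; ring.
Qed.

Lemma Rintegral_disk c : normc c < 1 ->
  \int[mu]_(t in `[0, 1]) ln (normc (1 + c * e t)) = 0.
Proof.
move=> c1; pose J c := \int[mu]_(t in `[0, 1]) ln (normc (1 + c * e t)).
pose B : R := ln 2 - ln (1 - normc c).
(* Stated for the whole disk of radius [|c|], which [z |-> - z^2] maps into itself, so that the
   induction can replace [z] by its image. *)
have key n : forall z, normc z <= normc c -> 2 ^+ n * `|J z| <= B.
  elim: n => [|n IH] z zc; have z1 := le_lt_trans zc c1.
    rewrite expr0 mul1r; apply: le_trans (le_normr_Rintegral _ (integrable_disk z1)) _ => //.
    rewrite -[leRHS]Rintegral01_cst; apply: le_Rintegral => //.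
    - exact: (integrable_norm (integrable_disk z1)).
    - exact: integrable_itv_cst.
    - move=> t _; apply: le_trans (ln_normc_bounds t z1) _.
      by rewrite lerD2l lerN2 ler_ln ?posrE; lra.
  have -> : 2 ^+ n.+1 * `|J z| = 2 ^+ n * `|J (- (z * z))|.
    by rewrite /J Rintegral_disk_double// normrM (ger0_norm (ler0n R 2)) exprSr mulrA.
  apply: IH; rewrite normcN Normc.normcM.
  by have := normc_ge0 z; nra.
apply/eqP/negPn/negP => J0; have Jp : 0 < `|J c| by rewrite normr_gt0.
(* This exponent [n] exceeds [B / |J c|], and [n < 2^n]. *)
have := key (Num.truncn (B / `|J c|)).+1 c (lexx _); apply/negP; rewrite -ltNge.
rewrite -ltr_pdivrMr//; apply: lt_le_trans (truncnS_gt _) _.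
by rewrite -natrX ler_nat ltnW// ltn_expl.
Qed.

Lemma measurable_ln_normc_add1 : measurable_fun setT (fun t => ln (normc (1 + e t))).
Proof. by have := measurable_ln_normc_circle 1 1; under eq_fun do rewrite mul1r. Qed.

Lemma integrable_ln_normc_add1_exp n :
  mu.-integrable `[0, 1] (fun t => (ln (normc (1 + e t)) ^+ n)%:E).
Proof.
have L := same_law_comp (@exprn_measurable R setT n)
  (same_law_logsin (@ln_normc_add1_expi2pi R)).
apply: (@same_law_integrable _ _ _ _ R mu mu pi^-1 `[0, 1]
  (fun t => ln (normc (1 + e t)) ^+ n) `[0, pi] (fun th => logsin th ^+ n)) => //;
  last exact: integrable_logsin_exp.
by apply: measurable_funTS; apply: measurable_funX; exact: measurable_ln_normc_add1.
Qed.

End jensen.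

(** * Jensen's formula for linear polynomials, and the resulting norm bound *)

Section jensen_formula.
Context {R : realType}.
Local Notation mu := (@lebesgue_measure R).
Local Notation normc := (@Normc.normc R).
Local Notation e := (@expi2pi R).
Implicit Types (c : R[i]).

Lemma integrable_ln_normc_add1 :
  mu.-integrable `[0, 1] (fun t => (ln (normc (1 + e t)))%:E).
Proof.
apply: eq_integrable (@integrable_ln_normc_add1_exp R 1) => //.
Qed.

(** With [g t = ln |1 - e t|], of the same integral [J] as [f], the doubling identity is
    [g (2 t) = f t + g t], whence [J = J + J]. It fails only at [0], [1/2] and [1], where a factor
    vanishes. *)
Lemma Rintegral_ln_normc_add1 : \int[mu]_(t in `[0, 1]) ln (normc (1 + e t)) = 0.
Proof.
pose f t := ln (normc (1 + e t)).
have h1 : 2^-1 <= 1 :> R by rewrite invf_le1// ler1n.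
have mf : measurable_fun setT f := @measurable_ln_normc_add1 R.
have fp t : f (t + 1) = f t by rewrite /f expi2pi_period.
have fi : mu.-integrable `[0, 1] (EFin \o f) := integrable_ln_normc_add1.
pose g t := f (t + 2^-1).
have mg : measurable_fun setT g.
  by apply: (measurableT_comp mf); exact: measurable_funD.
have gp t : g (t + 1) = g t by rewrite /g addrAC fp.
have gi : mu.-integrable `[0, 1] (EFin \o g) by exact: integrable_period_shift.
have gf : \int[mu]_(t in `[0, 1]) g t = \int[mu]_(t in `[0, 1]) f t.
  exact: Rintegral_period_shift.
have := Rintegral_period_double mg gp gi; rewrite gf.
rewrite (@eq_Rintegral_countable R `[0, 1] [set x | x \in [:: 0; 2^-1; 1]] _
    (fun t => f t + g t)) => //.
- rewrite RintegralD// gf; set J := (X in X + _ = _) => h.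
  by apply: (addrI J); rewrite addr0; exact: h.
- by apply: finite_set_countable; exact: finite_seq.
- by apply: (measurableT_comp mg); exact: measurable_funM.
- exact: measurable_funD.
move=> t; rewrite /= in_itv/= => /andP[t0 t1]; rewrite !inE => tS.
have tn0 : t != 0 by apply/eqP => t0'; apply: tS; rewrite t0' eqxx.
have tn1 : t != 1 by apply/eqP => t0'; apply: tS; rewrite t0' eqxx !orbT.
have tnh : t != 2^-1 by apply/eqP => t0'; apply: tS; rewrite t0' eqxx !orbT.
rewrite /g /f !expi2pi_Dhalf -ln_normcM.
- by congr (ln (normc _)); rewrite expi2pi_double; ring.
- by apply/eqP => /(expi2pi_eqN1 t0 t1) /eqP; rewrite (negbTE tnh).
- by apply: expi2pi_eq1; rewrite lt_neqAle ?t0 ?t1 ?andbT// eq_sym.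
Qed.

(** Factor out [e t], of norm 1, and conjugate. This puts [c + z] with [|c| < 1] in the form treated
    inside the disk. *)
Let normc_circle_flip c t : normc (c + e t) = normc (1 + c^*%C * e t).
Proof.
case: c => a b /=; congr Num.sqrt.
have := cos2Dsin2 (2 * pi * t); move: (cos _) (sin _) => u v uv.
apply/eqP; rewrite -subr_eq0; apply/eqP.
transitivity ((u ^+ 2 + v ^+ 2 - 1) * (1 - a ^+ 2 - b ^+ 2)); first by ring.
by rewrite uv subrr mul0r.
Qed.

(** Inside the disk the norm is flipped, outside it [c] is factored out, and on the circle a
    rotation reduces to [c = 1]. The formula covers [c = 0] because [ln 0 = 0] agrees there with the
    positive part of the logarithm. *)
Lemma jensen_integrable_and_value c :
  mu.-integrable `[0, 1] (fun t => (ln (normc (c + e t)))%:E) /\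
  \int[mu]_(t in `[0, 1]) ln (normc (c + e t)) = Num.max (ln (normc c)) 0.
Proof.
have [c1|c1|c1] := ltgtP (normc c) 1.
- have cc1 : normc (c^*)%C < 1 by case: c c1 => a b /=; rewrite sqrrN.
  split.
    apply: eq_integrable (integrable_disk cc1) => // t _.
    by rewrite normc_circle_flip.
  under eq_Rintegral do rewrite normc_circle_flip.
  rewrite Rintegral_disk//; apply/esym/max_idPr; apply: ln_le0; exact: ltW.
- have c0 : c != 0 by rewrite -normc_gt0 (lt_trans _ c1).
  have ci : normc c^-1 < 1 by rewrite Normc.normcV invf_lt1// (lt_trans _ c1).
  have E t : ln (normc (c + e t)) = ln (normc c) + ln (normc (1 + c^-1 * e t)).
    by rewrite -ln_normcM ?normc_disk_neq0// mulrDr mulr1 mulVKf.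
  split.
    apply: eq_integrable (integrableD _ (integrable_itv_cst 0 1 (ln (normc c)))
      (integrable_disk ci)) => // t _.
    by rewrite E EFinD.
  under eq_Rintegral do rewrite E.
  rewrite RintegralD//; [|exact: integrable_itv_cst|exact: integrable_disk].
  rewrite Rintegral01_cst Rintegral_disk// addr0; apply/esym/max_idPl.
  by apply: ln_ge0; exact: ltW.
- have [s [s0 s1 cE]] := expi2pi_surj c1.
  (* The rotation by [- s] is written [1 - s] to be a shift by an element of [[0, 1]]. *)
  have E t : ln (normc (c + e t)) = ln (normc (1 + e (t + (1 - s)))).
    rewrite cE; have -> : e s + e t = e s * (1 + e (t + (1 - s))).
      rewrite mulrDr mulr1 -expi2piD; congr (_ + _).
      by rewrite -[in LHS]expi2pi_period; congr expi2pi; ring.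
    by rewrite Normc.normcM normc_expi2pi mul1r.
  have m1 := @measurable_ln_normc_add1 R.
  have p t : ln (normc (1 + e (t + 1))) = ln (normc (1 + e t)) by rewrite expi2pi_period.
  have s'0 : 0 <= 1 - s by rewrite subr_ge0.
  have s'1 : 1 - s <= 1 by rewrite lerBlDr lerDl.
  split.
    apply: eq_integrable (integrable_period_shift s'0 s'1 m1 p integrable_ln_normc_add1) => // t _.
    by rewrite E.
  under eq_Rintegral do rewrite E.
  rewrite (Rintegral_period_shift s'0 s'1 m1 p integrable_ln_normc_add1).
  by rewrite Rintegral_ln_normc_add1 c1 ln1 maxxx.
Qed.

Let ln_normc_factor (a b : R[i]) t : b != 0 -> a / b + e t != 0 ->
  ln (normc (a + b * e t)) = ln (normc b) + ln (normc (a / b + e t)).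
Proof.
by move=> b0 h; rewrite -ln_normcM// mulrDr [b * (a / b)]mulrC divfK.
Qed.

Lemma measurable_ln_normc_addC c : measurable_fun setT (fun t => ln (normc (c + e t))).
Proof.
by have := measurable_ln_normc_circle c 1; under eq_fun do rewrite mul1r.
Qed.

Lemma jensen_integrable (a b : R[i]) : b != 0 ->
  mu.-integrable `[0, 1] (fun t => (ln (normc (a + b * e t)))%:E).
Proof.
move=> b0; have [fi _] := jensen_integrable_and_value (a / b).
apply: (@le_integrable _ _ _ mu _ _ _ (fun t =>
  ((`|ln (normc b)|)%:E + (`|ln (normc (a / b + e t))|)%:E)%E)) => //.
- by apply/measurable_EFinP; apply: measurable_funTS; exact: measurable_ln_normc_circle.
- move=> t _; rewrite -EFinD lee_fin [leRHS]ger0_norm ?addr_ge0//.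
  have [z|z] := eqVneq (a / b + e t) 0.
    have -> : a + b * e t = b * (a / b + e t) by rewrite mulrDr [b * (a / b)]mulrC divfK.
    by rewrite z mulr0 Normc.normc0 ln0// normr0 addr_ge0.
  by rewrite ln_normc_factor// ler_normD.
- apply: integrableD => //; first exact: integrable_itv_cst.
  exact: (integrable_norm fi).
Qed.

(** Two solutions less than one full turn apart coincide, so a solution [t0] leaves only [t0] and
    [t0 - 1], [t0 + 1] as candidates. *)
Lemma expi2pi_fiber_countable c : countable [set t | 0 <= t <= 1 /\ c + e t = 0].
Proof.
have [[t0 [/andP[t00 t01] c0]]|n] := pselect (exists t, 0 <= t <= 1 /\ c + e t = 0); last first.
  by rewrite (_ : mkset _ = set0)// -subset0 => t ht; apply: n; exists t.
apply: (@sub_countable _ _ _ [set` [:: t0; t0 - 1; t0 + 1]]); last first.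
  by apply: finite_set_countable; exact: finite_seq.
apply: subset_card_le => t /= [/andP[t_0 t_1] ct].
have shift u v : c + e u = 0 -> c + e v = 0 -> 1 - e (u - v) = 0.
  move=> /eqP; rewrite addrC addr_eq0 => /eqP eu /eqP; rewrite addrC addr_eq0 => /eqP ev.
  have : e (u - v) * e v = 1 * e v by rewrite -expi2piD subrK mul1r eu ev.
  by move/(mulIf (expi2pi_neq0 v)) ->; rewrite subrr.
rewrite !inE; have [tt|tt|->] := ltgtP t t0; last by [].
  have [h|h] := ltP (t0 - t) 1; last by apply/orP; right; apply/orP; left; apply/eqP; lra.
  by have := @expi2pi_eq1 R (t0 - t); rewrite subr_gt0 tt h shift// eqxx => /(_ isT isT).
have [h|h] := ltP (t - t0) 1; last by apply/orP; right; apply/orP; right; apply/eqP; lra.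
by have := @expi2pi_eq1 R (t - t0); rewrite subr_gt0 tt h shift// eqxx => /(_ isT isT).
Qed.

Lemma jensen (a b : R[i]) : a != 0 -> b != 0 ->
  \int[mu]_(t in `[0, 1]) ln (normc (a + b * e t)) =
  Num.max (ln (normc a)) (ln (normc b)).
Proof.
move=> a0 b0; have [fi fE] := jensen_integrable_and_value (a / b).
rewrite (eq_Rintegral_countable (g := fun t => ln (normc b) + ln (normc (a / b + e t)))
  _ (expi2pi_fiber_countable (a / b)))//.
- rewrite RintegralD//; last exact: integrable_itv_cst.
  rewrite Rintegral01_cst fE Normc.normcM Normc.normcV ln_div ?posrE ?normc_gt0//.
  rewrite -[in LHS](subrr (ln (normc b))) -addr_maxl.
  by rewrite addrC -addrA addNr addr0.
- exact: measurable_ln_normc_circle.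
- apply: measurable_funD => //; exact: measurable_ln_normc_addC.
- move=> t; rewrite /= in_itv/= => t01 tS; apply: ln_normc_factor => //.
  by apply/eqP => z; apply: tS.
Qed.

Lemma Rintegral_norm_ln_normc_le c :
  \int[mu]_(t in `[0, 1]) `|ln (normc (c + e t))| <= 2 * ln (1 + normc c).
Proof.
have [fi fE] := jensen_integrable_and_value c; have c0 := normc_ge0 c.
pose M : R := ln (1 + normc c).
have M0 : 0 <= M by apply: ln_ge0; rewrite lerDl.
apply: (@le_trans _ _ (\int[mu]_(t in `[0, 1]) (2 * M - ln (normc (c + e t))))).
  apply: le_Rintegral => //.
  - exact: (integrable_norm fi).
  - exact: eq_integrable (integrableB _ (integrable_itv_cst 0 1 (2 * M)) fi).
  - move=> t _; have le : ln (normc (c + e t)) <= M.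
      have [z|z] := leP (normc (c + e t)) 0.
        by rewrite (le_trans _ M0)// ln_le0// (le_trans z).
      rewrite ler_ln ?posrE//; last by lra.
      by rewrite (le_trans (ler_normcD _ _))// normc_expi2pi addrC.
    by rewrite ler_norml; apply/andP; split; lra.
rewrite RintegralB//; last exact: integrable_itv_cst.
by rewrite Rintegral01_cst fE lerBlDr lerDl le_max lexx orbT.
Qed.

End jensen_formula.

(** * From the positive part of a logarithm to a maximum of two logarithms *)

Section jensen_max.
Context {R : realType}.
Local Notation mu := (@lebesgue_measure R).
Local Notation normc := (@Normc.normc R).
Local Notation e := (@expi2pi R).

Lemma ln_normc_shift (a : R[i]) y z :
  ln (normc (a + (1 + e z) * e y)) = ln (normc (a + e y + e (z + y))).
Proof. by rewrite expi2piD mulrDl mul1r addrA. Qed.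

(* Both sides are the double integral of ln |a + e y + e z|: integrate over [z]
   first, resp. substitute [z := z + y] and integrate over [y] first. *)
Lemma Rintegral_max_ln_normc (a : R[i]) : a != 0 ->
  \int[mu]_(y in `[0, 1]) Num.max (ln (normc (a + e y))) 0 =
  \int[mu]_(z in `[0, 1]) Num.max (ln (normc a)) (ln (normc (1 + e z))).
Proof.
move=> a0; pose f (p : R * R) := ln (normc (a + (1 + e p.2) * e p.1)).
have mf : measurable_fun setT f.
  apply: measurable_ln_normc; apply: cmeasurableD; first exact: cmeasurable_cst.
  apply: cmeasurableM; last exact: cmeasurable_expi2pi.
  by apply: cmeasurableD; [exact: cmeasurable_cst|exact: cmeasurable_expi2pi].
have per y t : ln (normc (a + e y + e (t + 1))) = ln (normc (a + e y + e t)).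
  by rewrite expi2pi_period.
have mz y : measurable_fun setT (fun z => ln (normc (a + e y + e z))).
  exact: measurable_ln_normc_addC.
have fiz y : `[0, 1]%classic y -> mu.-integrable `[0, 1] (fun z => (f (y, z))%:E).
  rewrite /= in_itv/= => /andP[y0 y1].
  have [ji _] := jensen_integrable_and_value (a + e y).
  apply: eq_integrable (integrable_period_shift y0 y1 (mz y) (per y) ji) => // z _.
  by rewrite /f/= ln_normc_shift.
have fval y : `[0, 1]%classic y ->
    \int[mu]_(z in `[0, 1]) f (y, z) = Num.max (ln (normc (a + e y))) 0.
  rewrite /= in_itv/= => /andP[y0 y1].
  have [ji <-] := jensen_integrable_and_value (a + e y).
  rewrite -(Rintegral_period_shift y0 y1 (mz y) (per y) ji).
  by apply: eq_Rintegral => z _; rewrite /f/= ln_normc_shift.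
have fbnd y : `[0, 1]%classic y ->
    \int[mu]_(z in `[0, 1]) `|f (y, z)| <= 2 * ln (2 + normc a).
  rewrite /= in_itv/= => /andP[y0 y1].
  have [ji _] := jensen_integrable_and_value (a + e y).
  have -> : \int[mu]_(z in `[0, 1]) `|f (y, z)| =
      \int[mu]_(z in `[0, 1]) `|ln (normc (a + e y + e z))|.
    rewrite -(@Rintegral_period_shift R (fun z => `|ln (normc (a + e y + e z))|) y)//.
    - by apply: eq_Rintegral => z _; rewrite /f/= ln_normc_shift.
    - exact: measurableT_comp.
    - by move=> t; rewrite per.
    - exact: (integrable_norm ji).
  apply: le_trans (Rintegral_norm_ln_normc_le _) _.
  have := ler_normcD a (e y); rewrite normc_expi2pi.
  have := normc_ge0 a; have := normc_ge0 (a + e y) => h1 h2 h3.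
  by rewrite ler_pM2l// ler_ln ?posrE; lra.
have fi : (mu \x mu)%E.-integrable (`[0, 1] `*` `[0, 1]) (EFin \o f).
  apply: (@integrable_setX _ _ _ _ R mu mu _ _ _ _ f (fun=> 2 * ln (2 + normc a))) => //.
  exact: integrable_itv_cst.
transitivity (\int[mu]_(y in `[0, 1]) \int[mu]_(z in `[0, 1]) f (y, z)).
  by apply: eq_Rintegral => y; rewrite inE => y01; rewrite fval.
rewrite -Rintegral_setX12// Rintegral_setX21//; last first.
  (* Where [1 + e z] vanishes, the integrand is constant in [y]. *)
  move=> z _; rewrite /f/=; have [z0|z0] := eqVneq (1 + e z) 0.
    apply: eq_integrable (integrable_itv_cst 0 1 (ln (normc a))) => // y _.
    by rewrite z0 mul0r addr0.
  exact: jensen_integrable.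
(* At [1 + e z = 0] the left side is [ln |a|], but the right side is [max (ln |a|) 0] since
   [ln 0 = 0]. *)
apply: (eq_Rintegral_countable _ (expi2pi_fiber_countable 1)) => //.
- apply: (@measurable_section_Rintegral _ _ _ _ R mu _ _ (fun p => f (p.2, p.1))) => //.
  by apply: (measurableT_comp mf); exact: measurable_swap.
- by apply: measurable_maxr => //; exact: measurable_ln_normc_add1.
- move=> z; rewrite /= in_itv/= => z01 zS; rewrite /f/=; apply: jensen => //.
  by apply/eqP => z0; apply: zS.
Qed.

End jensen_max.

(** * Primitives and integration by parts *)

Section primitives.
Context {R : realType}.
Local Notation mu := (@lebesgue_measure R).
Variable b : R.
Implicit Types (u v : R -> R) (x y : R).

(** Truncating the integrand over a fixed interval makes this a section integral on a rectangle, so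
    measurability in [x] and Fubini apply directly. *)
Definition primitive_upto v x := \int[mu]_(y in `[0, b]) (if y <= x then v y else 0).

Lemma primitive_uptoE v x : x <= b ->
  primitive_upto v x = \int[mu]_(y in `[0, x]) v y.
Proof.
move=> xb; rewrite (_ : `[0, x]%classic = `[0, b] `&` [set y | y <= x]).
  rewrite Rintegral_mkcondr; apply: eq_Rintegral => y _; rewrite patchE.
  by congr (if _ then _ else _); apply/idP/idP; rewrite inE.
apply/seteqP; split => y /=; rewrite !in_itv/=.
  by move=> /andP[-> yx]; rewrite yx (le_trans yx).
by move=> [/andP[-> _] ->].
Qed.

Let measurable_truncate v : measurable_fun setT v ->
  measurable_fun setT (fun p : R * R => if p.2 <= p.1 then v p.2 else 0).
Proof.
move=> mv; apply: measurable_fun_ifT => //; first exact: measurable_fun_ler.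
exact: (measurableT_comp mv).
Qed.

Lemma measurable_primitive_upto v : measurable_fun setT v ->
  measurable_fun setT (primitive_upto v).
Proof.
move=> mv; apply: (@measurable_section_Rintegral _ _ _ _ R mu _ _
  (fun p => if p.2 <= p.1 then v p.2 else 0)) => //.
exact: measurable_truncate.
Qed.

Lemma integrable_truncate v x : measurable_fun setT v ->
  mu.-integrable `[0, b] (EFin \o v) ->
  mu.-integrable `[0, b] (fun y => (if y <= x then v y else 0)%:E).
Proof.
move=> mv vi; apply: le_integrable vi => //.
- apply/measurable_EFinP; apply: measurable_funTS.
  by apply: measurable_fun_ifT => //; exact: measurable_fun_ler.
- by move=> y _; rewrite lee_fin; case: ifP; rewrite // normr0.
Qed.

Lemma primitive_upto_norm_le v x : measurable_fun setT v ->
  mu.-integrable `[0, b] (EFin \o v) ->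
  `|primitive_upto v x| <= \int[mu]_(y in `[0, b]) `|v y|.
Proof.
move=> mv vi; apply: le_trans (le_normr_Rintegral _ (integrable_truncate _ _ vi)) _ => //.
apply: le_Rintegral => //.
- exact: (integrable_norm (integrable_truncate _ _ vi)).
- exact: (integrable_norm vi).
- by move=> y _; case: ifP; rewrite // normr0.
Qed.

Lemma integrable_mul_primitive u v : measurable_fun setT u -> measurable_fun setT v ->
  mu.-integrable `[0, b] (EFin \o u) -> mu.-integrable `[0, b] (EFin \o v) ->
  mu.-integrable `[0, b] (fun x => (u x * primitive_upto v x)%:E).
Proof.
move=> mu' mv ui vi; pose C := \int[mu]_(y in `[0, b]) `|v y|.
apply: (@le_integrable _ _ _ mu _ _ _ (fun x => (C%:E * (u x)%:E)%E)) => //.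
- apply/measurable_EFinP; apply: measurable_funTS; apply: measurable_funM => //.
  exact: measurable_primitive_upto.
- move=> x _; rewrite -EFinM lee_fin !normrM mulrC ler_wpM2r//.
  by apply: le_trans (ler_norm _); exact: primitive_upto_norm_le.
- exact: integrableZl.
Qed.

(* Fubini on the triangle [y <= x]. *)
Lemma Rintegral_mul_primitive u v : measurable_fun setT u -> measurable_fun setT v ->
  mu.-integrable `[0, b] (EFin \o u) -> mu.-integrable `[0, b] (EFin \o v) ->
  \int[mu]_(x in `[0, b]) (u x * primitive_upto v x) +
  \int[mu]_(x in `[0, b]) (v x * primitive_upto u x) =
  \int[mu]_(x in `[0, b]) v x * \int[mu]_(x in `[0, b]) u x.
Proof.
move=> mu' mv ui vi.
pose f (p : R * R) := u p.1 * (if p.2 <= p.1 then v p.2 else 0).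
have mf : measurable_fun setT f.
  apply: measurable_funM; first exact: (measurableT_comp mu').
  exact: measurable_truncate.
pose C := \int[mu]_(y in `[0, b]) `|v y|.
have f1 x : mu.-integrable `[0, b] (fun y => (f (x, y))%:E).
  by apply: eq_integrable (integrableZl _ (u x) (integrable_truncate x mv vi)).
have f2 y : mu.-integrable `[0, b] (fun x => (f (x, y))%:E).
  apply: (@le_integrable _ _ _ mu _ _ _ (fun x => ((v y)%:E * (u x)%:E)%E)) => //.
  - by apply/measurable_EFinP; apply: measurable_funTS; exact: (measurable_fun_pair1 y mf).
  - move=> x _; rewrite -EFinM lee_fin /f/= !normrM mulrC ler_wpM2r//.
    by case: ifP; rewrite // normr0.
  - exact: integrableZl.
have fi : (mu \x mu)%E.-integrable (`[0, b] `*` `[0, b]) (EFin \o f).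
  apply: (@integrable_setX _ _ _ _ R mu mu _ _ _ _ f (fun x => C * `|u x|)) => //.
  - move=> x _; rewrite mulrC -RintegralZl//; last exact: (integrable_norm vi).
    apply: le_Rintegral => //.
    + exact: (integrable_norm (f1 x)).
    + exact: (integrableZl _ `|u x| (integrable_norm vi)).
    + move=> y _; rewrite /f/= normrM ler_wpM2l//.
      by case: ifP; rewrite // normr0.
  - by apply: (integrableZl _ C (integrable_norm ui)).
have -> : \int[mu]_(x in `[0, b]) (u x * primitive_upto v x) =
    \int[mu]_(x in `[0, b]) \int[mu]_(y in `[0, b]) f (x, y).
  by apply: eq_Rintegral => x _; rewrite -RintegralZl//; exact: integrable_truncate.
rewrite -Rintegral_setX12// Rintegral_setX21//.
have -> : \int[mu]_(y in `[0, b]) \int[mu]_(x in `[0, b]) f (x, y) =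
   \int[mu]_(y in `[0, b]) (v y * \int[mu]_(x in `[0, b]) u x - v y * primitive_upto u y).
  apply: eq_Rintegral => y _; rewrite -mulrBr -RintegralB//; last exact: integrable_truncate.
  rewrite -RintegralZl//; last exact: (integrableB _ ui (integrable_truncate y mu' ui)).
  (* The indicators of [y <= x] and [x <= y] add up to [1] except on the diagonal. *)
  apply: (eq_Rintegral_countable (S := [set y])) => //.
  - exact: (measurable_fun_pair1 y mf).
  - apply: measurable_funM => //; apply: measurable_funB => //.
    by apply: measurable_fun_ifT => //; exact: measurable_fun_ler.
  - move=> x _ /eqP xy; rewrite /f/=; have [xy'|xy'|xy'] := ltgtP x y.
    + by rewrite subrr !mulr0.
    + by rewrite subr0 mulrC.
    + by rewrite xy' eqxx in xy.
rewrite RintegralB//; [|exact: (integrableZr _ _ vi)|exact: integrable_mul_primitive].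
by rewrite RintegralZr// subrK.
Qed.

End primitives.

(** * Reduction of the Mahler measure to one integral over the circle *)

Section assembly.
Context {R : realType}.
Local Notation mu := (@lebesgue_measure R).
Local Notation normc := (@Normc.normc R).
Local Notation e := (@expi2pi R).
Local Notation f := (fun t : R => ln (normc (1 + e t))).
Variable k : nat.

Definition circle_max (u : R) : R := \int[mu]_(y in `[0, 1]) Num.max u (f y).

Let mf : measurable_fun setT f := @measurable_ln_normc_add1 R.

Let mfst : measurable_fun setT (fun p : R * R => f p.1 ^+ k).
Proof. by apply: measurable_funX; exact: (measurableT_comp mf). Qed.

Let normc_add1_le x : normc (1 + e x) <= 2.
Proof.
by have := ler_normcD 1 (e x); rewrite Normc.normc1 normc_expi2pi; lra.
Qed.

Let normc_add2_le x y : normc (1 + e x + e y) <= 3.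
Proof.
have := ler_normcD (1 + e x) (e y); rewrite normc_expi2pi.
by have := normc_add1_le x; lra.
Qed.

(** Integrating over [z] first turns the logarithm into its positive part, and
    [Rintegral_max_ln_normc] with [a = 1 + e x] turns the remaining [y]-integral into
    [circle_max]. *)
Lemma mahler3_double_integral :
  mahler3 (nseq k (fun x _ _ => 1 + x) ++ [:: fun x y z => 1 + x + y + z]) =
  \int[mu]_(x in `[0, 1]) (f x ^+ k * circle_max (f x)).
Proof.
pose h (p : (R * R) * R) := f p.1.1 ^+ k * ln (normc (1 + e p.1.1 + e p.1.2 + e p.2)).
pose h2 (p : R * R) := f p.1 ^+ k * Num.max (ln (normc (1 + e p.1 + e p.2))) 0.
have mfk : measurable_fun setT (fun p : (R * R) * R => f p.1.1 ^+ k).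
  exact: (@measurableT_comp _ _ _ _ _ _ (fun p : R * R => f p.1 ^+ k) _ fst).
have ml2 : measurable_fun setT (fun p : R * R => ln (normc (1 + e p.1 + e p.2))).
  apply: measurable_ln_normc; apply: cmeasurableD; last exact: cmeasurable_expi2pi.
  by apply: cmeasurableD; [exact: cmeasurable_cst|exact: cmeasurable_expi2pi].
have mh : measurable_fun setT h.
  apply: measurable_funM => //; apply: measurable_ln_normc.
  apply: cmeasurableD; last exact: cmeasurable_expi2pi.
  apply: cmeasurableD.
    apply: cmeasurableD; first exact: cmeasurable_cst.
    by apply: cmeasurable_expi2pi; exact: measurableT_comp.
  by apply: cmeasurable_expi2pi; exact: measurableT_comp.
have mh2 : measurable_fun setT h2.
  by apply: measurable_funM => //; exact: measurable_maxr.
have hz p : mu.-integrable `[0, 1] (fun z => (h (p, z))%:E).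
  have [ji _] := jensen_integrable_and_value (1 + e p.1 + e p.2).
  by apply: eq_integrable (integrableZl _ (f p.1 ^+ k) ji).
(* The [4] bounds [1 + |1 + e x + e y|]. *)
have hbnd p : \int[mu]_(z in `[0, 1]) `|h (p, z)| <= `|f p.1 ^+ k| * (2 * ln 4).
  have [ji _] := jensen_integrable_and_value (1 + e p.1 + e p.2).
  rewrite (_ : \int[mu]_(z in `[0, 1]) `|h (p, z)| =
      `|f p.1 ^+ k| * \int[mu]_(z in `[0, 1]) `|ln (normc (1 + e p.1 + e p.2 + e z))|).
    rewrite ler_wpM2l//; apply: le_trans (Rintegral_norm_ln_normc_le _) _.
    rewrite ler_pM2l// ler_ln ?posrE//; last by have := normc_ge0 (1 + e p.1 + e p.2); lra.
    by have := normc_add2_le p.1 p.2; lra.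
  rewrite -RintegralZl//; last exact: (integrable_norm ji).
  by apply: eq_Rintegral => z _; rewrite normrM.
have fki : mu.-integrable `[0, 1] (fun x => (f x ^+ k)%:E) := integrable_ln_normc_add1_exp k.
have gi : (mu \x mu)%E.-integrable (`[0, 1] `*` `[0, 1])
    (fun p : R * R => (`|f p.1 ^+ k| * (2 * ln 4))%:E).
  apply: (@integrable_setX _ _ _ _ R mu mu _ _ _ _
    (fun p => `|f p.1 ^+ k| * (2 * ln 4)) (fun x => `|2 * ln 4| * `|f x ^+ k|)) => //.
  - by apply: measurable_funM => //; exact: measurableT_comp.
  - by move=> x _; exact: (integrable_itv_cst 0 1 (`|f x ^+ k| * (2 * ln 4))).
  - by move=> x _ /=; rewrite Rintegral01_cst normrM normr_id mulrC.
  - exact: (integrableZl _ `|2 * ln 4| (integrable_norm fki)).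
pose mu2 := sigma_finite_product mu mu.
have hi : (mu2 \x mu)%E.-integrable ((`[0, 1] `*` `[0, 1]) `*` `[0, 1]) (EFin \o h).
  apply: (@integrable_setX _ _ _ _ R mu2 mu _ _ _ _ h
    (fun p => `|f p.1 ^+ k| * (2 * ln 4))) => //.
  exact: measurableX.
have h2b x y : `|Num.max (ln (normc (1 + e x + e y))) 0| <= ln 3.
  rewrite ger0_norm ?le_max ?lexx ?orbT// ge_max ln_ge0 ?ler1n// andbT.
  have [z|z] := leP (normc (1 + e x + e y)) 0.
    by rewrite ln0//; apply: ln_ge0; rewrite ler1n.
  by rewrite ler_ln ?posrE.
have h2y x : mu.-integrable `[0, 1] (fun y => (h2 (x, y))%:E).
  apply: (@integrable_itv_bounded _ _ _ (`|f x ^+ k| * ln 3)).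
    exact: (measurable_fun_pair2 x mh2).
  by move=> y; rewrite normrM ler_wpM2l.
have h2i : (mu \x mu)%E.-integrable (`[0, 1] `*` `[0, 1]) (EFin \o h2).
  apply: (@integrable_setX _ _ _ _ R mu mu _ _ _ _ h2 (fun x => ln 3 * `|f x ^+ k|)) => //.
  - move=> x _; rewrite -[leRHS]Rintegral01_cst; apply: le_Rintegral => //.
    + exact: (integrable_norm (h2y x)).
    + exact: integrable_itv_cst.
    + by move=> y _; rewrite normrM mulrC ler_wpM2r.
  - exact: (integrableZl _ (ln 3) (integrable_norm fki)).
transitivity (\int[(mu2 \x mu)%E]_(p in (`[0, 1] `*` `[0, 1]) `*` `[0, 1]) h p).
  rewrite /mahler3 /leb3 (_ : @unit_cube3 R = (`[0, 1] `*` `[0, 1]) `*` `[0, 1]).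
    apply: eq_Rintegral => p _; rewrite big_cat/= big_nseq big_seq1; congr (_ * _).
    by rewrite iter_mulr_1.
  by apply/seteqP; split => p /=; [move=> [? [? ?]]|move=> [[? ?] ?]].
rewrite Rintegral_setX12//; last exact: measurableX.
transitivity (\int[(mu \x mu)%E]_(p in `[0, 1] `*` `[0, 1]) h2 p).
  apply: eq_Rintegral => p _.
  have [ji jE] := jensen_integrable_and_value (1 + e p.1 + e p.2).
  by rewrite /h2 -jE -RintegralZl.
rewrite Rintegral_setX12//.
(* The discarded parameters are those with [1 + e x = 0], where [a] would vanish. *)
apply: (eq_Rintegral_countable _ (expi2pi_fiber_countable 1)) => //.
- exact: measurable_section_Rintegral.
- apply: measurable_funM; first exact: measurable_funX.
  apply: (@measurable_section_Rintegral _ _ _ _ R mu _ _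
    (fun p => Num.max (f p.1) (f p.2))) => //.
  by apply: measurable_maxr; exact: (measurableT_comp mf).
move=> x; rewrite /= in_itv/= => x01 xS.
have x0 : 1 + e x != 0 by apply/eqP => z; apply: xS.
transitivity (f x ^+ k * \int[mu]_(y in `[0, 1]) Num.max (ln (normc (1 + e x + e y))) 0).
  rewrite -RintegralZl//.
  apply: (@integrable_itv_bounded _ _ _ (ln 3)); last by move=> y; exact: h2b.
  by apply: measurable_maxr => //; exact: (measurable_fun_pair2 x ml2).
by congr (_ * _); exact: Rintegral_max_ln_normc.
Qed.

End assembly.

(** * Passage to log-sine integrals on [[0, pi]] *)

Section log_sine_form.
Context {R : realType}.
Local Notation mu := (@lebesgue_measure R).
Local Notation normc := (@Normc.normc R).
Local Notation e := (@expi2pi R).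
Local Notation f := (fun t : R => ln (normc (1 + e t))).
Local Notation G := (@logsin R).

Let pi0 : 0 < pi :> R. Proof. exact: pi_gt0. Qed.

Lemma integrable_logsin : mu.-integrable `[0, pi] (EFin \o G).
Proof. by apply: eq_integrable (@integrable_logsin_exp R 1). Qed.

Lemma Rintegral_comp_logsin (g : R -> R) : measurable_fun setT g ->
  mu.-integrable `[0, pi] (EFin \o (g \o G)) ->
  \int[mu]_(t in `[0, 1]) g (f t) = pi^-1 * \int[mu]_(th in `[0, pi]) g (G th).
Proof.
move=> mg gi; have L := same_law_comp mg (same_law_logsin (@ln_normc_add1_expi2pi R)).
apply: (@same_law_Rintegral _ _ _ _ R mu mu pi^-1 `[0, 1] (g \o f) `[0, pi] (g \o G)) => //.
by apply: measurable_funTS; apply: (measurableT_comp mg); exact: measurable_ln_normc_add1.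
Qed.

Lemma Rintegral_logsin : \int[mu]_(th in `[0, pi]) G th = 0.
Proof.
have := @Rintegral_comp_logsin id (@measurable_id _ _ _) integrable_logsin.
rewrite Rintegral_ln_normc_add1 => /esym/eqP; rewrite mulf_eq0 invr_eq0 gt_eqF//.
by move=> /eqP.
Qed.

Lemma circle_max_logsin u :
  circle_max u = pi^-1 * \int[mu]_(ph in `[0, pi]) Num.max u (G ph).
Proof.
apply: Rintegral_comp_logsin; first exact: measurable_maxr.
apply: le_integrable (integrableD _ (integrable_itv_cst 0 pi `|u|) (integrable_norm integrable_logsin)) => //.
  apply/measurable_EFinP; apply: measurable_funTS.
  by apply: measurable_maxr => //; exact: measurable_logsin.
move=> x _; rewrite -EFinD lee_fin [leRHS]ger0_norm ?addr_ge0//=.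
by rewrite maxEle; case: ifP; rewrite ?lerDl ?lerDr.
Qed.

Lemma measurable_circle_max : measurable_fun setT (@circle_max R).
Proof.
rewrite (_ : @circle_max R = fun u => circle_max u)// /circle_max.
apply: (@measurable_section_Rintegral _ _ _ _ R mu _ _
  (fun p : R * R => Num.max p.1 (f p.2))) => //.
apply: measurable_maxr => //.
exact: (measurableT_comp (@measurable_ln_normc_add1 R)).
Qed.

Lemma logsinE (th : R) : 0 <= th -> th <= pi -> G th = ln (2 * sin (th / 2)).
Proof.
move=> t0 tpi; rewrite /logsin ger0_norm// mulr_ge0// sin_ge0_pi//.
by apply/andP; split; lra.
Qed.

Lemma logsin_le (x y : R) : 0 < x -> x <= y -> y <= pi -> G x <= G y.
Proof.
move=> x0 xy ypi; rewrite !logsinE; try by lra.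
have sx : 0 < sin (x / 2) by apply: sin_gt0_pi; apply/andP; split; lra.
have sxy : sin (x / 2) <= sin (y / 2).
  have [->//|nxy] := eqVneq x y.
  have {nxy xy}xy : x < y by rewrite lt_neqAle nxy.
  by apply: ltW; rewrite ltr_sin ?in_itv/=; try (apply/andP; split); lra.
by rewrite ler_ln ?posrE; lra.
Qed.

(** By monotonicity the maximum is [G ph] plus [G th - G ph] on [ph <= th], and [G] has integral
    [0]. The point [ph = 0] is set aside because of the conventional value [G 0 = 0]. *)
Lemma Rintegral_max_logsin (th : R) : 0 < th -> th <= pi ->
  \int[mu]_(ph in `[0, pi]) Num.max (G th) (G ph) = th * G th - primitive_upto pi G th.
Proof.
move=> t0 tpi; have mG := @measurable_logsin R.
have mlt : measurable_fun setT (fun x : R => x <= th) by exact: measurable_fun_ler.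
have ct : \int[mu]_(ph in `[0, pi]) (if ph <= th then G th else 0) = th * G th.
  rewrite [LHS](primitive_uptoE (fun=> G th) tpi) Rintegral_cst//= lebesgue_measure_itv/=.
  by rewrite lte_fin t0 oppr0 addr0 mulrC.
rewrite (eq_Rintegral_countable (S := [set 0]) (g := fun ph => G ph +
    ((if ph <= th then G th else 0) - (if ph <= th then G ph else 0))))//.
- have i1 := integrable_truncate th (@measurable_cst _ _ _ _ setT (G th)) (integrable_itv_cst 0 pi (G th)).
  have i2 := integrable_truncate th mG integrable_logsin.
  rewrite RintegralD//; [|exact: integrable_logsin|exact: (integrableB _ i1 i2)].
  by rewrite Rintegral_logsin add0r RintegralB// ct.
- exact: measurable_maxr.
- apply: measurable_funD => //.
  by apply: measurable_funB; exact: measurable_fun_ifT.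
- move=> x; rewrite /= in_itv/= => /andP[x0 xpi] xn0.
  have xp : 0 < x by rewrite lt_neqAle x0 andbT eq_sym; exact/eqP.
  have [xt|tx] := leP x th.
    by rewrite addrC subrK; apply/max_idPl; exact: logsin_le.
  by rewrite subrr addr0; apply/max_idPr; apply: logsin_le => //; exact: ltW.
Qed.

Variable k : nat.

Lemma integrable_id_mul_logsin :
  mu.-integrable `[0, pi] (fun th => (th * G th ^+ k.+1)%:E).
Proof.
apply: le_integrable (integrableZl _ pi (integrable_logsin_exp k.+1)) => //.
  apply/measurable_EFinP; apply: measurable_funTS; apply: measurable_funM => //.
  exact: measurable_funX measurable_logsin.
move=> x; rewrite /= in_itv/= => /andP[x0 xpi].
by rewrite lee_fin !normrM ler_wpM2r// !ger0_norm// ltW.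
Qed.

Lemma integrable_logsin_primitive :
  mu.-integrable `[0, pi] (fun th => (G th ^+ k * primitive_upto pi G th)%:E).
Proof.
apply: integrable_mul_primitive.
- exact: measurable_funX measurable_logsin.
- exact: measurable_logsin.
- exact: integrable_logsin_exp.
- exact: integrable_logsin.
Qed.

(** One factor [pi^-1] comes from the variable [x], the other from the average inside
    [circle_max]. *)
Lemma Rintegral_circle_max :
  \int[mu]_(x in `[0, 1]) (f x ^+ k * circle_max (f x)) =
  (pi ^+ 2)^-1 * (\int[mu]_(th in `[0, pi]) (th * G th ^+ k.+1) -
    \int[mu]_(th in `[0, pi]) (G th ^+ k * primitive_upto pi G th)).
Proof.
have mG := @measurable_logsin R.
pose F th := pi^-1 * (th * G th ^+ k.+1 - G th ^+ k * primitive_upto pi G th).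
have iF : mu.-integrable `[0, pi] (EFin \o F).
  exact: (integrableZl _ pi^-1 (integrableB _ integrable_id_mul_logsin integrable_logsin_primitive)).
have mg : measurable_fun setT (fun u : R => u ^+ k * circle_max u).
  by apply: measurable_funM; [exact: measurable_funX|exact: measurable_circle_max].
have FE th : 0 < th -> th <= pi -> G th ^+ k * circle_max (G th) = F th.
  by move=> t0 tpi; rewrite circle_max_logsin Rintegral_max_logsin// /F exprS; ring.
rewrite (Rintegral_comp_logsin mg); last first.
  apply: integrable_obnd_cbnd; first exact: measurableT_comp.
  have iF' : mu.-integrable `]0, pi] (EFin \o F).
    by apply: integrableS iF => // x; rewrite /= !in_itv/= => /andP[/ltW -> ->].
  apply: eq_integrable iF' => // x; rewrite inE/= in_itv/= => /andP[x0 xpi].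
  by rewrite FE.
rewrite (eq_Rintegral_countable (S := [set 0]) (g := F))//.
- rewrite /F RintegralZl//; last first.
    exact: (integrableB _ integrable_id_mul_logsin integrable_logsin_primitive).
  rewrite RintegralB//; [|exact: integrable_id_mul_logsin|exact: integrable_logsin_primitive].
  by rewrite mulrA -invfM -expr2.
- exact: (measurableT_comp mg mG).
- apply: measurable_funM => //; apply: measurable_funB.
    by apply: measurable_funM => //; exact: measurable_funX.
  apply: measurable_funM; first exact: measurable_funX.
  exact: measurable_primitive_upto.
- move=> x; rewrite /= in_itv/= => /andP[x0 xpi] xn0; apply: FE => //.
  by rewrite lt_neqAle x0 andbT eq_sym; exact/eqP.
Qed.

Lemma Ls_primitive n th : 0 <= th -> th <= pi ->
  Ls n.+1 th = - primitive_upto pi (fun x => G x ^+ n) th.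
Proof. by move=> t0 tpi; rewrite /Ls /oint0 t0 primitive_uptoE. Qed.

Lemma Ls2_primitive th : 0 <= th -> th <= pi -> Ls 2 th = - primitive_upto pi G th.
Proof.
by move=> t0 tpi; rewrite Ls_primitive.
Qed.

Lemma Lsj_logsin : Lsj (k + 3) 1 pi = - \int[mu]_(th in `[0, pi]) (th * G th ^+ k.+1).
Proof.
rewrite /Lsj /oint0 (ltW pi0); congr (- _); apply: eq_Rintegral => x _.
by rewrite expr1 addn3 /= subn1.
Qed.

End log_sine_form.

Unset Implicit Arguments.

Theorem theorem3p5 (R : realType) (k : nat) :
  let Ps : seq (R[i] -> R[i] -> R[i] -> R[i]) :=
    nseq k (fun x _ _ => 1 + x) ++ [:: fun x y z => 1 + x + y + z] in
  mahler3 Ps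
    = - (pi ^+ 2)^-1 * Lsj (k + 3) 1 pi
      + (pi ^+ 2)^-1 * \int[@lebesgue_measure R]_(th in `[0, pi])
            (Ls 2 th * (ln (2 * sin (th / 2))) ^+ k)
  /\
  mahler3 Ps
    = - (pi ^+ 2)^-1 * Lsj (k + 3) 1 pi
      - (pi ^+ 2)^-1 * \int[@lebesgue_measure R]_(th in `[0, pi])
            (Ls (k + 1) th * ln (2 * sin (th / 2))).
Proof.
move=> Ps; rewrite /Ps mahler3_double_integral Rintegral_circle_max Lsj_logsin.
set A := (X in X - _); set B := (X in _ - X).
have mG := @measurable_logsin R; have iG := @integrable_logsin R.
have mGk : measurable_fun setT (fun th : R => logsin th ^+ k) by exact: measurable_funX.
have iGk := @integrable_logsin_exp R k.
have neg (h : R -> R) : lebesgue_measure.-integrable `[0, pi] (fun th : R => (h th)%:E) ->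
    \int[@lebesgue_measure R]_(th in `[0, pi]) - h th =
    - \int[@lebesgue_measure R]_(th in `[0, pi]) h th.
  by move=> hi; rewrite -mulN1r -RintegralZl//; apply: eq_Rintegral => x _; rewrite mulN1r.
have -> : \int[@lebesgue_measure R]_(th in `[0, pi])
    (Ls 2 th * (ln (2 * sin (th / 2))) ^+ k) = - B.
  rewrite -neg; last exact: integrable_logsin_primitive.
  apply: eq_Rintegral => x; rewrite inE/= in_itv/= => /andP[x0 xpi].
  by rewrite Ls2_primitive// logsinE// mulNr mulrC.
have -> : \int[@lebesgue_measure R]_(th in `[0, pi])
    (Ls (k + 1) th * ln (2 * sin (th / 2))) = B.
  (* The product term of the integration by parts contains the integral of [logsin], so it vanishes
     and the two integrals are opposite. *)
  have := Rintegral_mul_primitive mGk mG iGk iG.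
  rewrite Rintegral_logsin mul0r -/B => /eqP; rewrite addr_eq0 => /eqP ->.
  rewrite -neg; last exact: integrable_mul_primitive.
  apply: eq_Rintegral => x; rewrite inE/= in_itv/= => /andP[x0 xpi].
  by rewrite addn1 Ls_primitive// logsinE// mulNr mulrC.
by split; rewrite mulrNN mulrBr ?mulrN.
Qed.
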